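(* Let $\Gamma$ be the periodic graph over $\mathbb{Z}$ in which each $n\in\mathbb{Z}$ is connected to $n+k$, $k\neq 0$, with edge weight $w(k)$, where $w(k)=k^{-2}$ for odd $k$, $w(k)=2k^{-2}$ for $k\in 2\mathbb{Z}\setminus4\mathbb{Z}$, and $w(k)=0$ for $k\in4\mathbb{Z}$. Let $\mathcal{A}_\Gamma$ be its adjacency operator on $\ell^2(\mathbb{Z})$. Then $\Gamma$ satisfies the following: (i) $\mathcal{A}_\Gamma$ has an infinitely degenerate eigenvalue $\lambda_0$. (ii) There is no eigenvector of finite support corresponding to $\lambda_0$. (iii) A spectral band of $\mathcal{A}_\Gamma$ is partly flat, i.e. the Floquet eigenvalue function $E(\cdot)$ is constant on a set of positive measure, but not on the whole torus $\mathbb{T}$. Each of (i), (ii) or (iii) is impossible in the locally finite setting.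
   Context: $\mathbb{T}=\mathbb{R}/\mathbb{Z}$ and $(\mathcal{A}_\Gamma\psi)(n)=\sum_{k}w(k)\psi(n+k)$. An infinitely degenerate eigenvalue is an eigenvalue of infinite multiplicity. Since the fundamental cell of $\Gamma$ has one vertex, there is a single Floquet eigenvalue function, $E(\theta)=\sum_{k\in\mathbb{Z}}w(k)e^{2\pi ik\theta}$, $\theta\in\mathbb{T}$; its range is the only spectral band. The locally finite setting is that of connected $\mathbb{Z}^d$-periodic graphs with finite fundamental cell (and periodic potential) in which every vertex has only finitely many neighbours. There, the impossibility of (i) concerns graphs which, like $\Gamma$, have a fundamental cell consisting of a single vertex: such graphs have no flat bands. The impossibility of (ii) means that to each flat band there is an eigenvector of finite support, and that of (iii) means that a spectral band is either entirely flat or almost everywhere non-constant.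
   Formalization: For the impossibility of (iii), bands are continuous periodic eigenvalue functions that list each flat band, with multiplicity, as constant functions; with eigenvalues in increasing order the claim fails where a flat band crosses another (eigenvalues 0 and 4cos(2πθ)). *)

(* Defs.v *)
From HB Require Import structures.
From mathcomp Require Import all_boot all_order all_algebra.
From mathcomp Require Import complex.
From mathcomp Require Import all_classical all_reals all_analysis.

Set Implicit Arguments.
Unset Strict Implicit.
Unset Printing Implicit Defensive.

Import Order.TTheory GRing.Theory Num.Theory.
Import numFieldNormedType.Exports.

Local Open Scope classical_set_scope.
Local Open Scope ring_scope.
Local Open Scope complex_scope.

Section Operators.
Variables (R : realType) (V : choiceType) (H : (V -> R[i]) -> V -> R[i]).

Definition sqnorm (z : R[i]) : R := complex.Re z ^+ 2 + complex.Im z ^+ 2.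

Definition l2 (psi : V -> R[i]) : Prop :=
  (\esum_(x in [set: V]) (sqnorm (psi x))%:E < +oo)%E.

Definition eigenspace_l2 (lambda : R[i]) : set (V -> R[i]) :=
  [set psi | l2 psi /\ forall x, H psi x = lambda * psi x].

Definition eigenvector (lambda : R[i]) (psi : V -> R[i]) : Prop :=
  eigenspace_l2 lambda psi /\ exists x, psi x != 0.

Definition infinitely_degenerate (lambda : R[i]) : Prop :=
  forall n : nat, exists psi : 'I_n -> V -> R[i],
    (forall i, eigenspace_l2 lambda (psi i)) /\
    (forall c : 'I_n -> R[i],
       (forall x, \sum_(i < n) c i * psi i x = 0) -> forall i, c i = 0).

Definition finite_support_eigenvector (lambda : R[i]) (psi : V -> R[i]) : Prop :=
  eigenvector lambda psi /\ finite_set [set x | psi x != 0].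

End Operators.

Section Gamma.
Variable R : realType.

(* e^(it) *)
Definition expi (t : R) : R[i] := cos t +i* sin t.

(* All the two-sided series below converge absolutely, so that the order of
   summation is irrelevant. *)
Definition zsum (u : int -> R) : R :=
  limn (series (fun k => u (Posz k))) + limn (series (fun k => u (Negz k))).

Definition czsum (u : int -> R[i]) : R[i] :=
  zsum (fun k => complex.Re (u k)) +i* zsum (fun k => complex.Im (u k)).

Definition gamma_weight (k : int) : R :=
  if (4 %| k)%Z then 0
  else if (2 %| k)%Z then 2 * k%:~R ^- 2
  else k%:~R ^- 2.

Definition gamma_adjacency (psi : int -> R[i]) (n : int) : R[i] :=
  czsum (fun k => (gamma_weight k)%:C * psi (n + k)).

Definition gamma_floquet (theta : R) : R[i] :=
  czsum (fun k => (gamma_weight k)%:C * expi (2 * pi * k%:~R * theta)).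

Definition constant_on (T U : Type) (S : set T) (f : T -> U) : Prop :=
  exists c, forall t, S t -> f t = c.

End Gamma.

(* The vertices are the pairs (a, n), a in the fundamental cell 'I_nu and n in
   Z^d; the translation by k sends (a, n) to (a, n + k).  The weight of the edge
   between (a, n) and (b, n + k) is [weight a b k], and there is an edge if and
   only if it is nonzero. *)
Record periodic_graph (R : realType) (d nu : nat) := PeriodicGraph {
  weight : 'I_nu -> 'I_nu -> 'rV[int]_d -> R;
  potential : 'I_nu -> R;
  weight_sym : forall a b k, weight a b k = weight b a (- k);
  weight_loopless : forall a, weight a a 0 = 0
}.

Section PeriodicGraphTheory.
Variables (R : realType) (d nu : nat) (G : periodic_graph R d nu).

Definition vertex : choiceType := ('I_nu * 'rV[int]_d)%type.

Definition edge_weight (x y : vertex) : R := weight G x.1 y.1 (y.2 - x.2).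

Definition adjacent (x y : vertex) : bool := edge_weight x y != 0.

Definition connected_graph : Prop :=
  forall x y : vertex, exists p : seq vertex, path adjacent x p /\ last x p = y.

Definition locally_finite_graph : Prop :=
  forall x : vertex, finite_set [set y | adjacent x y].

(* \sum_(_ \in _) is a sum over the support of the summand, which is finite on
   locally finite graphs. *)
Definition schrodinger (psi : vertex -> R[i]) (x : vertex) : R[i] :=
  \sum_(y \in [set: vertex]) ((edge_weight x y)%:C * psi y)
  + (potential G x.1)%:C * psi x.

Definition dot (k : 'rV[int]_d) (theta : 'rV[R]_d) : R :=
  \sum_(i < d) (k 0 i)%:~R * theta 0 i.

(* Action of [schrodinger] on the functions (b, n) |-> u b * e^{2 i pi n.theta}. *)
Definition floquet (theta : 'rV[R]_d) : 'M[R[i]]_nu :=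
  \matrix_(a, b)
    (\sum_(k \in [set: 'rV[int]_d])
        ((weight G a b k)%:C * expi (2 * pi * dot k theta))
     + (potential G a)%:C *+ (a == b)).

Definition flat_band (lambda : R[i]) : Prop :=
  forall theta, eigenvalue (floquet theta) lambda.

(* Functions on the torus are Z^d-periodic functions on R^d.  The last clause is
   the convention that flat bands are bands: an eigenvalue of multiplicity >= m
   of every Floquet matrix is listed as m constant band functions.  (Listing the
   eigenvalues in increasing order instead would cut a flat band into pieces
   where it crosses another band.) *)
Definition band_functions (E : 'I_nu -> 'rV[R]_d -> R) : Prop :=
  [/\ forall j, continuous (E j),
      forall j theta (k : 'rV[int]_d), E j (theta + map_mx intr k) = E j theta,
      forall theta,
        char_poly (floquet theta) = \prod_(j < nu) ('X - ((E j theta)%:C)%:P)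
    & forall (lambda : R) (m : nat),
        (forall theta, (m <= mup lambda%:C (char_poly (floquet theta)))%N) ->
        (m <= #|[set j : 'I_nu | `[< forall theta, E j theta = lambda >]]|)%N].

End PeriodicGraphTheory.

Section NullSets.
Variables (R : realType) (d : nat).

(* A fundamental domain of R^d / Z^d. *)
Definition torus : set 'rV[R]_d := [set theta | forall i, 0 <= theta 0 i < 1].

(* Lebesgue-null subsets of R^d, through coverings by countably many boxes. *)
Definition lebesgue_null (A : set 'rV[R]_d) : Prop :=
  forall eps : R, 0 < eps -> exists a b : nat -> 'rV[R]_d,
    [/\ forall n i, a n 0 i <= b n 0 i,
        A `<=` \bigcup_n [set x | forall i, a n 0 i <= x 0 i <= b n 0 i]
      & (\sum_(0 <= n <oo) (\prod_(i < d) (b n 0 i - a n 0 i))%:E <= eps%:E)%E].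

End NullSets.

(* Main.v *)
Require Import Defs.
From mathcomp Require Import all_boot all_order all_algebra.
From mathcomp Require Import complex.
From mathcomp Require Import all_classical all_reals all_analysis.
From mathcomp Require Import ring lra zify.

(* Floquet eigenvalue of Gamma.  Up to O(1/N), its partial sums are
   2 f_N(x) + f_N(2x), where x = 2 pi theta and
   f_N(x) = sum_(i < N) cos((2i+1)x)/(2i+1)^2.  Their derivative is
   -2 (s_N(x) - s_N(2x - pi)), and s_N(t) = sum_(i < N) sin((2i+1)t)/(2i+1) converges
   to a constant on (0, pi); hence E is constant on [5/16, 3/8].  The Fourier
   coefficients of the indicator functions of subintervals are then eigenvectors.  A
   finitely supported eigenvector psi would make sum_m w(m - n) psi(m) vanish for large
   |n| in a given residue class mod 4: this is a rational function of n with genuine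
   double poles.

   Locally finite graphs.  The translates of an l2 eigenvector, or the Bloch waves of a
   flat band, restricted to a box of side M, span a space of dimension >= c M^d: by the
   bound |tr A|^2 <= rank A * ||A||^2 in the first case, by orthogonality of the
   characters in the second one.  The boundary layer has only O(M^(d-1)) vertices, so
   some combination vanishes on it and can be cut off.  With one vertex per cell there
   is no finitely supported eigenvector: take an additive functional l : Z^d -> Z
   separating the points of the support of the weight, and compare its maximum there
   with its minimum on the support of the eigenvector.

   Bands.  The coefficients of the characteristic polynomial of the Floquet matrix are
   trigonometric polynomials in theta.  Counting points of the grid (1/N) Z^d where such
   a polynomial is small, by induction on d, shows that its zero set is null unless it
   vanishes identically.  Applied to the m-th Taylor coefficient at lambda, m being the
   least multiplicity of lambda over all theta, this shows that the multiplicity of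
   lambda exceeds m on a null set only.  Band functions are obtained by listing each
   lambda m(lambda) times, then the remaining eigenvalues in increasing order. *)

Set Implicit Arguments.
Unset Strict Implicit.
Unset Printing Implicit Defensive.

Import Order.TTheory GRing.Theory Num.Theory.
Import numFieldNormedType.Exports.
Local Open Scope classical_set_scope.
Local Open Scope ring_scope.
Local Open Scope complex_scope.

(** * Complex moduli and exponentials *)

Section ComplexModulus.
Variable R : realType.
Implicit Types z : R[i].

(** The modulus as an element of [R]: the norm of [R[i]] takes its values in [R[i]]. *)
Definition nc (z : R[i]) : R := Normc.normc z.

Lemma nc0 : nc 0 = 0. Proof. exact: Normc.normc0. Qed.
Lemma nc1 : nc 1 = 1. Proof. exact: Normc.normc1. Qed.
Lemma ncM z1 z2 : nc (z1 * z2) = nc z1 * nc z2. Proof. exact: Normc.normcM. Qed.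
Lemma ncD z1 z2 : nc (z1 + z2) <= nc z1 + nc z2. Proof. exact: le_normcD. Qed.
Lemma ncN z : nc (- z) = nc z. Proof. exact: normcN. Qed.
Lemma nc_ge0 z : 0 <= nc z. Proof. by case: z => a b; exact: sqrtr_ge0. Qed.
Lemma nc_eq0 z : (nc z == 0) = (z == 0).
Proof. by apply/eqP/eqP => [/Normc.eq0_normc //|->]; exact: nc0. Qed.
Lemma nc_gt0 z : (0 < nc z) = (z != 0).
Proof. by rewrite lt_def nc_ge0 andbT nc_eq0. Qed.

Lemma nc_sum (I : Type) (r : seq I) (P : pred I) (F : I -> R[i]) :
  nc (\sum_(i <- r | P i) F i) <= \sum_(i <- r | P i) nc (F i).
Proof.
elim/big_ind2: _ => [|x1 x2 y1 y2 h1 h2|//]; first by rewrite nc0.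
by apply: (le_trans (ncD _ _)); exact: lerD.
Qed.

Lemma nc_prod (I : Type) (r : seq I) (P : pred I) (F : I -> R[i]) :
  nc (\prod_(i <- r | P i) F i) = \prod_(i <- r | P i) nc (F i).
Proof. exact: (big_morph nc ncM nc1). Qed.

Lemma sqnormE z : sqnorm z = nc z ^+ 2.
Proof. by case: z => a b; rewrite /sqnorm /nc /= sqr_sqrtr // addr_ge0 ?sqr_ge0. Qed.

Lemma sqnorm_ge0 z : 0 <= sqnorm z. Proof. by rewrite sqnormE sqr_ge0. Qed.

Lemma nc_real (x : R) : nc x%:C = `|x|.
Proof. by rewrite /nc /= expr0n addr0 sqrtr_sqr. Qed.

End ComplexModulus.

Section MeanValue.
Variable R : realType.

Lemma norm_mean_value (f df : R -> R) (K a b : R) :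
  a <= b -> (forall x, a <= x <= b -> is_derive x 1 f (df x)) ->
  (forall x, a <= x <= b -> `|df x| <= K) -> `|f b - f a| <= K * (b - a).
Proof.
move=> ab dfE dfK; have [|||c + ->] := @MVT_segment R f df a b => //.
- move=> x; rewrite in_itv /= => /andP[ax xb].
  by apply: dfE; rewrite !ltW.
- apply: derivable_within_continuous => x; rewrite in_itv /= => xab.
  by have := dfE x xab => /@ex_derive.
rewrite in_itv /= => cab.
by rewrite normrM (ger0_norm (_ : 0 <= b - a)) ?subr_ge0// ler_wpM2r ?subr_ge0// dfK.
Qed.

Lemma sin_le_norm (x : R) : `|sin x| <= `|x|.
Proof.
wlog x0 : x / 0 <= x => [h|].
  by case: (leP 0 x) => [/h//|/ltW x0]; rewrite -normrN -sinN -(normrN x) h ?oppr_ge0.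
have := @norm_mean_value sin cos 1 0 x x0.
rewrite sin0 !subr0 mul1r (ger0_norm x0); apply => y _ //; exact: cos_max.
Qed.

End MeanValue.

Section Expi.
Variable R : realType.

Lemma expi0 : expi (0 : R) = 1.
Proof. by rewrite /expi cos0 sin0. Qed.

Lemma expiD (a b : R) : expi (a + b) = expi a * expi b.
Proof.
by rewrite /expi cosD sinD; apply/eqP; rewrite eq_complex /= eqxx addrC eqxx.
Qed.

Lemma nc_expi (a : R) : nc (expi a) = 1.
Proof. by rewrite /nc /= cos2Dsin2 sqrtr1. Qed.

Lemma expi_neq0 (a : R) : expi a != 0.
Proof. by rewrite -nc_gt0 nc_expi. Qed.

Lemma expiN (a : R) : expi (- a) = (expi a)^-1.
Proof.
by apply: (mulIf (expi_neq0 a)); rewrite -expiD addNr expi0 mulVf ?expi_neq0.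
Qed.

Lemma expiX (a : R) n : expi (n%:R * a) = expi a ^+ n.
Proof.
elim: n => [|n IH]; first by rewrite mul0r expi0.
by rewrite -[n.+1]addn1 natrD mulrDl mul1r expiD IH addn1 exprSr.
Qed.

Lemma expi_sum (I : Type) (r : seq I) (P : pred I) (F : I -> R) :
  expi (\sum_(i <- r | P i) F i) = \prod_(i <- r | P i) expi (F i).
Proof. exact: (big_morph _ expiD expi0). Qed.

Lemma expi_2pi_nat n : expi (2 * pi * n%:R : R) = 1.
Proof.
rewrite mulrC expiX mulr_natl /expi cos2pi sin2pi.
by have -> : 1 +i* 0 = 1 :> R[i] by []; rewrite expr1n.
Qed.

Lemma expi_2pi_int (k : int) : expi (2 * pi * k%:~R : R) = 1.
Proof.
case: k => n; first exact: expi_2pi_nat.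
by rewrite NegzE intrN mulrN expiN expi_2pi_nat invr1.
Qed.

Lemma conjc_expi (a : R) : (expi a)^*%C = expi (- a).
Proof. by rewrite /expi cosN sinN. Qed.

(** Half-angle formulas; squaring avoids the square root in the modulus. The resulting chord length
    underlies the Lipschitz bound and the arc counts. *)
Lemma sqr_nc_expi_sub1 (a : R) : nc (expi a - 1) ^+ 2 = (2 * sin (a / 2)) ^+ 2.
Proof.
rewrite -sqnormE /sqnorm /expi /= subr0.
have -> : cos a = 1 - 2 * sin (a / 2) ^+ 2.
  rewrite [in LHS](_ : a = (a / 2) *+ 2); last by field.
  by rewrite cos_mulr2n cos2sin2; ring.
have -> : sin a ^+ 2 = 4 * sin (a / 2) ^+ 2 * (1 - sin (a / 2) ^+ 2).
  rewrite [in LHS](_ : a = (a / 2) *+ 2); last by field.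
  by rewrite sin_mulr2n -cos2sin2; ring.
by ring.
Qed.

Lemma nc_expi_sub1 (a : R) : nc (expi a - 1) = `|2 * sin (a / 2)|.
Proof.
by apply/eqP; rewrite -(@eqrXn2 _ 2) ?nc_ge0// sqr_nc_expi_sub1 real_normK ?num_real.
Qed.

Lemma nc_expi_sub (a b : R) : nc (expi a - expi b) = `|2 * sin ((a - b) / 2)|.
Proof.
rewrite -nc_expi_sub1 -[LHS]mulr1 -(nc_expi (- b)) -ncM mulrBl -!expiD subrr expi0.
by [].
Qed.

Lemma expi_lipschitz (a b : R) : nc (expi a - expi b) <= `|a - b|.
Proof.
rewrite nc_expi_sub normrM ger0_norm//.
have := sin_le_norm ((a - b) / 2); rewrite normrM (ger0_norm (_ : 0 <= 2^-1)) //.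
lra.
Qed.

(** The chord from [1] has length [2 |sin (pi t)|], and the sine is positive strictly between [0]
    and [pi]. *)
Lemma expi_neq1 (t : R) : 0 < `|t| < 1 -> expi (2 * pi * t) != 1.
Proof.
move=> /andP[t0 t1]; rewrite -subr_eq0 -nc_eq0 nc_expi_sub1 normr_eq0 mulf_neq0//.
rewrite -(normr_eq0 (sin _)) (_ : 2 * pi * t / 2 = pi * t); last by field.
have -> : `|sin (pi * t)| = `|sin (pi * `|t|)|.
  by case: (ger0P t) => _ //; rewrite mulrN sinN normrN.
rewrite normr_eq0 gt_eqF// sin_gt0_pi// mulr_gt0 ?pi_gt0//=.
by rewrite -[ltRHS]mulr1 ltr_pM2l ?pi_gt0.
Qed.

End Expi.

(** The sum is the supremum of its finite partial sums; duplicate-free sequences turn these into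
    ordinary big operators. *)
Lemma l2P (R : realType) (V : choiceType) (psi : V -> R[i]) :
  l2 psi <-> exists S : R, forall s : seq V, uniq s -> \sum_(x <- s) sqnorm (psi x) <= S.
Proof.
have sE (s : seq V) : uniq s ->
    (\sum_(x \in [set` s]) (sqnorm (psi x))%:E = (\sum_(x <- s) sqnorm (psi x))%:E)%E.
  by move=> us; rewrite -fsbig_seq// sumEFin.
have e0 : (0 <= \esum_(x in [set: V]) (sqnorm (psi x))%:E)%E.
  by apply: esum_ge0 => x _; rewrite lee_fin sqnorm_ge0.
split=> [fin|[S hS]].
- exists (fine (\esum_(x in [set: V]) (sqnorm (psi x))%:E)%E) => s us.
  rewrite -lee_fin fineK ?ge0_fin_numE// -sE//.
  by apply: ereal_sup_ubound; exists [set` s] => //; split => //; exact: finite_seq.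
- apply: (@le_lt_trans _ _ S%:E); last exact: ltry.
  apply: ub_ereal_sup => _ [F [Ffin _] <-].
  have /finite_seqP[s0 Fs0] := Ffin.
  have -> : F = [set` undup s0] by rewrite Fs0; apply/seteqP; split=> x /=; rewrite mem_undup.
  by rewrite sE ?undup_uniq// lee_fin hS ?undup_uniq.
Qed.

Lemma dotDl (R : realType) d (k k' : 'rV[int]_d) (theta : 'rV[R]_d) :
  dot (k + k') theta = dot k theta + dot k' theta.
Proof.
by rewrite /dot -big_split /=; apply: eq_bigr => i _; rewrite mxE intrD mulrDl.
Qed.

(** * Finitely supported eigenvectors of locally finite graphs *)

(** Lagrange's identity: the squares of all [a i * b j - a j * b i] add up to twice the gap between
    the two sides. *)
Lemma sum_cauchy_schwarz (R : realFieldType) (I : finType) (a b : I -> R) :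
  (\sum_i a i * b i) ^+ 2 <= (\sum_i a i ^+ 2) * (\sum_i b i ^+ 2).
Proof.
have h : 0 <= \sum_i \sum_j (a i * b j - a j * b i) ^+ 2.
  by apply: sumr_ge0 => i _; apply: sumr_ge0 => j _; exact: sqr_ge0.
have e : \sum_i \sum_j (a i * b j - a j * b i) ^+ 2 =
   2 * ((\sum_i a i ^+ 2) * (\sum_i b i ^+ 2) - (\sum_i a i * b i) ^+ 2).
  rewrite (eq_bigr (fun i => \sum_j (a i ^+ 2 * b j ^+ 2 + b i ^+ 2 * a j ^+ 2
     - 2 * ((a i * b i) * (a j * b j))))); last first.
    by move=> i _; apply: eq_bigr => j _; ring.
  rewrite (eq_bigr (fun i => a i ^+ 2 * (\sum_j b j ^+ 2) + b i ^+ 2 * (\sum_j a j ^+ 2)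
     - 2 * ((a i * b i) * (\sum_j (a j * b j))))); last first.
    by move=> i _; rewrite !sumrB !big_split /= -!mulr_sumr.
  rewrite sumrB big_split /= -!mulr_suml -mulr_sumr -mulr_suml; ring.
by move: h; rewrite e pmulr_rge0// subr_ge0.
Qed.

(** * Rank and Hilbert-Schmidt norm *)

Section RankBound.
Variable R : realType.
Local Notation C := R[i].

Definition adjmx m n (A : 'M[C]_(m, n)) : 'M[C]_(n, m) := map_mx conjc A^T.

Lemma adjmxM m n p (A : 'M[C]_(m, n)) (B : 'M[C]_(n, p)) :
  adjmx (A *m B) = adjmx B *m adjmx A.
Proof. by rewrite /adjmx trmx_mul map_mxM. Qed.

Lemma adjmxK m n (A : 'M[C]_(m, n)) : adjmx (adjmx A) = A.
Proof. by apply/matrixP => i j; rewrite !mxE conjcK. Qed.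

Lemma mxtrace_adjmx m n (A : 'M[C]_(m, n)) :
  \tr (A *m adjmx A) = (\sum_i \sum_j nc (A i j) ^+ 2)%:C.
Proof.
rewrite rmorph_sum; apply: eq_bigr => i _; rewrite !mxE rmorph_sum.
apply: eq_bigr => j _; rewrite !mxE -sqr_normc; case: (A i j) => a b /=.
by rewrite normc_def /= rmorphXn.
Qed.

(** The trace of [A *m adjmx A] is the sum of the squared moduli of all entries of [A]. *)
Lemma mulmx_adjmx_eq0 m n (A : 'M[C]_(m, n)) : A *m adjmx A = 0 -> A = 0.
Proof.
move=> h; have := mxtrace_adjmx A; rewrite h mxtrace0 => /esym/eqP.
rewrite -(rmorph0 (real_complex R)) (inj_eq (@complexI R)) psumr_eq0 => [/allP h2|i _]; last first.
  by apply: sumr_ge0 => j _; exact: sqr_ge0.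
apply/matrixP => i j; rewrite mxE; apply/eqP.
have /= := h2 i (mem_index_enum _); rewrite psumr_eq0 => [/allP/(_ j (mem_index_enum _))|k _];
  last exact: sqr_ge0.
by rewrite /= sqrf_eq0 nc_eq0.
Qed.

(* The trace of [A] is the Hilbert-Schmidt product of [A] with the orthogonal
   projection onto its row space, whose squared norm is the rank. *)
Lemma mxtrace_rank_bound n (A : 'M[C]_n) :
  nc (\tr A) ^+ 2 <= (\rank A)%:R * \sum_i \sum_j nc (A i j) ^+ 2.
Proof.
have [V [Vfree AleV]] : exists V : 'M[C]_(\rank A, n), row_free V /\ (A <= V)%MS.
  by exists (row_base A); rewrite row_base_free eq_row_base.
(* Gram matrix of a basis of the row space; it is invertible since [u *m G = 0] makes [u *m V] a
   vector of norm zero. *)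
set G := V *m adjmx V.
have Gunit : G \in unitmx.
  rewrite -row_free_unit; apply: inj_row_free => u uG.
  have /mulmx_adjmx_eq0/eqP : (u *m V) *m adjmx (u *m V) = 0.
    by rewrite adjmxM mulmxA -(mulmxA u) uG mul0mx.
  by rewrite mulmx_free_eq0 // => /eqP.
have Gsa : adjmx G = G by rewrite adjmxM adjmxK.
(* The orthogonal projection onto the row space: it fixes [A] and is self-adjoint and idempotent. *)
pose P := adjmx V *m invmx G *m V.
have AP : A *m P = A.
  have /submxP[B AB] := AleV; have -> : A *m P = B *m V *m P by rewrite -AB.
  by rewrite /P -!mulmxA (mulmxA V) -/G (mulmxA G) mulmxV // mul1mx -AB.
have Psa : adjmx P = P.
  rewrite /P !adjmxM adjmxK mulmxA; congr (_ *m _ *m _).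
  by rewrite /adjmx trmx_inv map_invmx -/(adjmx G) Gsa.
have PP : P *m P = P.
  by rewrite /P -!mulmxA (mulmxA V) -/G (mulmxA G) mulmxV // mul1mx.
have trP : \tr P = (\rank A)%:R.
  by rewrite /P -mulmxA mxtrace_mulC -mulmxA -/G mulVmx // mxtrace1.
(* Since [P] is self-adjoint and idempotent, its squared Hilbert-Schmidt norm is its trace. *)
have PHS : \sum_i \sum_j nc (P i j) ^+ 2 = (\rank A)%:R.
  by apply: (@complexI R); rewrite -mxtrace_adjmx Psa PP trP rmorph_nat.
rewrite -PHS mulrC.
have -> : \sum_i \sum_j nc (P i j) ^+ 2 = \sum_(p : 'I_n * 'I_n) nc (P p.2 p.1) ^+ 2.
  by rewrite exchange_big /= pair_big.
rewrite [X in X * _]pair_big /=.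
(* Cauchy-Schwarz is applied to [tr A = tr (A P)], the sum of the products [A i j * P j i]. *)
apply: le_trans (sum_cauchy_schwarz _ _).
rewrite lerXn2r ?nnegrE ?nc_ge0//; first by apply: sumr_ge0 => p _; rewrite mulr_ge0 ?nc_ge0.
rewrite -[in leLHS]AP -(pair_bigA _ (fun i j => nc (A i j) * nc (P j i))) /=.
apply: le_trans (nc_sum _ _ _) _; apply: ler_sum => i _.
rewrite mxE; apply: le_trans (nc_sum _ _ _) _; apply: ler_sum => j _.
by rewrite ncM.
Qed.

End RankBound.

Lemma l2_finite_support (R : realType) (V : choiceType) (psi : V -> R[i]) :
  finite_set [set x | psi x != 0] -> l2 psi.
Proof.
move=> /finite_seqP[r hr]; apply/l2P.
exists (\sum_(x <- undup r) sqnorm (psi x)) => q uq.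
rewrite (bigID (mem (undup r))) /= [X in _ + X]big1 ?addr0; last first.
  move=> x; rewrite mem_undup => xr; have : ~ [set` r] x by apply/negP.
  rewrite -hr /= => /negP; rewrite negbK => /eqP ->.
  by rewrite sqnormE nc0 expr0n.
rewrite -big_filter [leRHS](bigID (mem q)) /= -[X in _ <= X + _]big_filter.
rewrite (perm_big [seq i <- undup r | i \in q]) /=.
  by rewrite lerDl; apply: sumr_ge0 => x _; exact: sqnorm_ge0.
apply: uniq_perm; rewrite ?filter_uniq ?undup_uniq// => x.
by rewrite !mem_filter andbC.
Qed.

(** The complement of the layer is a product of equal intervals with at least [M - 4 * r] points
    each. *)
Lemma card_layer d nu M r : (4 * r <= M)%N ->
  (#|[set x : 'I_nu * {ffun 'I_d -> 'I_M} |
      ~~ [forall i, (2 * r <= x.2 i)%N && (x.2 i + 2 * r < M)%N]]%SET|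
    <= nu * (M ^ d - (M - 4 * r) ^ d))%N.
Proof.
move=> rM; set core := fun t : {ffun 'I_d -> 'I_M} =>
  [forall i, (2 * r <= t i)%N && (t i + 2 * r < M)%N].
have -> : [set x : 'I_nu * {ffun 'I_d -> 'I_M} | ~~ core x.2]%SET =
    finset.setX [set: 'I_nu]%SET (~: [set t | core t])%SET.
  by apply/setP => x; rewrite !inE.
rewrite cardsX cardsT card_ord leq_mul2l cardsCs finset.setCK card_ffun !card_ord.
apply/orP; right; apply: leq_sub2l.
pose A : pred 'I_M := [pred j : 'I_M | (2 * r <= j)%N && (j + 2 * r < M)%N].
have cE : [set t | core t]%SET =i ([pred t | t \in ffun_on A] : pred {ffun 'I_d -> 'I_M}).
  by move=> t; rewrite !inE; apply/forallP/ffun_onP.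
rewrite (eq_card cE) cardE -cardE card_ffun_on card_ord.
have : (M - 4 * r <= #|A|)%N.
  have lt_sh (j : 'I_(M - 4 * r)) : (j + 2 * r < M)%N by have := ltn_ord j; lia.
  pose f j := Ordinal (lt_sh j).
  have finj : injective f by move=> i j /(congr1 val) /= /addIn /val_inj.
  rewrite -[leqLHS]card_ord -(card_imset predT finj); apply: subset_leq_card.
  by apply/fintype.subsetP => _ /imsetP[j _ ->]; rewrite inE /=; have := ltn_ord j; lia.
have expmono x y e : (x <= y)%N -> (x ^ e <= y ^ e)%N by case: e => // e; rewrite leq_exp2r.
exact: expmono.
Qed.

(** The layer is a surface term: its size is O(1/M) relative to the volume [M ^ d]. *)
Lemma layer_small (R : realType) d nu r (c : R) : 0 < c -> exists M : nat, [/\ (4 * r <= M)%N, (0 < M)%N &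
  (nu * (M ^ d - (M - 4 * r) ^ d))%:R < c * (M ^ d)%:R].
Proof.
move=> c0; set q := (4 * r)%N.
(* Bernoulli's inequality [M^d - (M - q)^d <= d q M^(d-1)], multiplied by [M] and written without a
   difference of powers. *)
have key M : (q <= M)%N -> (M ^ d * M <= (M - q) ^ d * M + d * q * M ^ d)%N.
  move=> qM; elim: d => [|e IH]; first by rewrite !expn0; lia.
  have h : ((M - q) ^ e <= M ^ e)%N by case: e {IH} => // e; rewrite leq_exp2r ?leq_subr.
  rewrite !expnS; move: IH h; set X := (M ^ e)%N; set Y := ((M - q) ^ e)%N.
  have [z Mz] : exists z, M = (q + z)%N by exists (M - q)%N; lia.
  rewrite {}Mz addKn in X Y *; rewrite -/X -/Y => IH h.
  have := leq_mul IH (leqnn (q + z)); have := leq_mul h (leqnn (q * (q + z))); nia.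
pose B := (nu * (d * q))%:R / c.
have B0 : 0 <= B by rewrite divr_ge0 ?ler0n ?ltW.
exists (Num.truncn B + q).+1; set M := (_.+1).
have qM : (q <= M)%N by rewrite /M; lia.
have BM : B < M%:R.
  apply: lt_le_trans (truncnS_gt B) _.
  by rewrite ler_nat ltnS leq_addr.
split => //.
have M0 : (0 : R) < M%:R by rewrite ltr0n.
have h : (nu * (M ^ d - (M - q) ^ d) * M <= nu * (d * q) * M ^ d)%N.
  by rewrite -!mulnA leq_mul2l mulnBl mulnA; have := key M qM; lia.
rewrite -(ltr_pM2r M0) -natrM; apply: (@le_lt_trans _ _ (nu * (d * q) * M ^ d)%:R).
  by rewrite ler_nat.
rewrite natrM mulrAC ltr_pM2r ?ltr0n ?expn_gt0// mulrC -ltr_pdivrMr//.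
Qed.

(** * Finite-range operators and truncation to a box *)

Section FiniteRange.
Variables (R : realType) (d nu : nat) (G : periodic_graph R d nu).
Local Notation C := R[i].
Local Notation vtx := (vertex d nu).

(** By periodicity the neighbours of the finitely many vertices [(a, 0)] account for all nonzero
    weights. *)
Lemma locally_finite_range : locally_finite_graph G ->
  exists s : seq 'rV[int]_d, uniq s /\ forall a b k, weight G a b k != 0 -> k \in s.
Proof.
move=> lf.
have /fin_all_exists[f hf] (a : 'I_nu) : exists s : seq 'rV[int]_d,
    forall b k, weight G a b k != 0 -> k \in s.
  have /finite_seqP[s hs] := lf (a, 0).
  exists [seq y.2 | y <- s] => b k wk; apply/mapP; exists (b, k) => //.
  have : [set y | Defs.adjacent G (a, 0) y] (b, k) by rewrite /= /Defs.adjacent /edge_weight /= subr0.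
  by rewrite hs.
exists (undup (flatten [seq f a | a <- enum 'I_nu])); rewrite undup_uniq; split=> // a b k wk.
rewrite mem_undup; apply/flattenP; exists (f a); last exact: hf wk.
by apply/mapP; exists a => //; rewrite mem_enum.
Qed.

Variables (s : seq 'rV[int]_d).
Hypothesis us : uniq s.
Hypothesis ws : forall a b k, weight G a b k != 0 -> k \in s.

(** Vertices are indexed by their displacement [k] from the given one; displacements outside [s]
    carry weight zero. *)
Lemma schrodingerE (psi : vtx -> C) a n :
  schrodinger G psi (a, n) =
  \sum_b \sum_(k <- s) (weight G a b k)%:C * psi (b, n + k) + (potential G a)%:C * psi (a, n).
Proof.
rewrite /schrodinger /=; congr (_ + _).
pose F (y : vtx) := (edge_weight G (a, n) y)%:C * psi y.
pose r := [seq (b, n + k) : vtx | b <- enum 'I_nu, k <- s].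
have ur : uniq r.
  apply: allpairs_uniq; rewrite ?enum_uniq// => -[b k] [b' k'] _ _ /= [-> /eqP].
  by rewrite (inj_eq (addrI n)) => /eqP ->.
rewrite (_ : \sum_(y \in [set: vtx]) F y = \sum_(y <- r) F y).
  rewrite /r big_allpairs_dep big_enum /=; apply: eq_bigr => b _; apply: eq_bigr => k _.
  by rewrite /F /edge_weight /= addrC addKr.
rewrite [RHS]fsbig_seq// (fsbig_widen [set` r] setT)// => -[b m] [_ /= hm].
have [w0|wn0] := eqVneq (weight G a b (m - n)) 0.
  by rewrite /preimage /= /F /edge_weight /= w0 mul0r.
exfalso; apply: hm; apply/allpairsP; exists (b, m - n) => /=.
by split; rewrite ?mem_enum ?(ws wn0)// addrC subrK.
Qed.

Lemma floquetE theta a b : floquet G theta a b =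
  \sum_(k <- s) (weight G a b k)%:C * expi (2 * pi * dot k theta)
  + (potential G a)%:C *+ (a == b).
Proof.
rewrite mxE; congr (_ + _); rewrite [RHS]fsbig_seq// (fsbig_widen [set` s] setT)// => k [_ /= hk].
have [w0|wn0] := eqVneq (weight G a b k) 0; first by rewrite /preimage /= w0 mul0r.
by exfalso; apply: hk; exact: ws wn0.
Qed.

Lemma eq_schrodinger (phi psi : vtx -> C) a n :
  (forall b k, k \in s -> phi (b, n + k) = psi (b, n + k)) -> phi (a, n) = psi (a, n) ->
  schrodinger G phi (a, n) = schrodinger G psi (a, n).
Proof.
move=> e e0; rewrite !schrodingerE e0; congr (_ + _).
by apply: eq_bigr => b _; rewrite !big_seq; apply: eq_bigr => k ks; rewrite e.
Qed.

Lemma schrodinger0 x : schrodinger G (fun=> 0) x = 0.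
Proof.
case: x => a n; rewrite schrodingerE mulr0 addr0 big1// => b _.
by rewrite big1// => k _; rewrite mulr0.
Qed.

Lemma schrodinger_sum K (c : 'I_K -> C) (psi : 'I_K -> vtx -> C) x :
  schrodinger G (fun y => \sum_i c i * psi i y) x = \sum_i c i * schrodinger G (psi i) x.
Proof.
case: x => a n; rewrite schrodingerE.
under [RHS]eq_bigr do rewrite schrodingerE mulrDr.
rewrite big_split /=; congr (_ + _); last first.
  by rewrite mulr_sumr; apply: eq_bigr => i _; rewrite mulrCA.
under [RHS]eq_bigr do rewrite mulr_sumr.
rewrite [RHS]exchange_big /=; apply: eq_bigr => b _.
under [RHS]eq_bigr do rewrite mulr_sumr.
rewrite [RHS]exchange_big /=; apply: eq_bigr => k _.
by rewrite mulr_sumr; apply: eq_bigr => i _; rewrite mulrCA.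
Qed.

Lemma schrodinger_translate (psi : vtx -> C) m a n :
  schrodinger G (fun y => psi (y.1, y.2 + m)) (a, n) = schrodinger G psi (a, n + m).
Proof.
rewrite !schrodingerE /=; congr (_ + _); apply: eq_bigr => b _; apply: eq_bigr => k _.
by rewrite addrAC.
Qed.

Lemma range_bound : exists r : nat, forall k, k \in s -> forall i, (`|k ord0 i| <= r)%N.
Proof.
exists (\max_(k <- s) \max_i absz (k ord0 i)) => k ks i.
apply: (@leq_trans (\max_i absz (k ord0 i))); first exact: (leq_bigmax i).
exact: (@leq_bigmax_seq _ s xpredT (fun k : 'rV[int]_d => \max_i absz (k ord0 i)) k).
Qed.

Definition box_point M (t : {ffun 'I_d -> 'I_M}) : 'rV[int]_d := \row_i (t i : nat)%:Z.

Definition box_vertex M (x : 'I_nu * {ffun 'I_d -> 'I_M}) : vtx := (x.1, box_point x.2).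

(* A combination of the solutions [psi i] which vanishes on the layer can be cut
   off outside of the box and still solves the equation. *)
Lemma truncate_solutions (lambda : C) M r K (psi : 'I_K -> vtx -> C) :
  (forall k, k \in s -> forall i, (`|k ord0 i| <= r)%N) -> (4 * r <= M)%N ->
  (forall i x, schrodinger G (psi i) x = lambda * psi i x) ->
  (nu * (M ^ d - (M - 4 * r) ^ d) <
    \rank (\matrix_(i < K, j < #|{: 'I_nu * {ffun 'I_d -> 'I_M}}|)
             psi i (box_vertex (enum_val j))))%N ->
  exists phi, finite_support_eigenvector (schrodinger G) lambda phi.
Proof.
move=> hr rM sol; set X := ('I_nu * {ffun 'I_d -> 'I_M})%type; set B := \matrix_(_, _) _.
move=> rkB.
pose L := [set x : X | ~~ [forall i, (2 * r <= x.2 i)%N && (x.2 i + 2 * r < M)%N]]%SET.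
pose BL := \matrix_(i < K, j < #|L|) psi i (box_vertex (enum_val j)).
(* The restriction to the layer has rank at most the size of the layer, hence smaller than the rank
   of [B]: some combination vanishes on the layer but not on the whole box. *)
have [c [cBL cB]] : exists c : 'rV[C]_K, c *m BL = 0 /\ c *m B != 0.
  have : ~~ (kermx BL <= kermx B)%MS.
    apply/negP => /mxrankS; rewrite !mxrank_ker => h.
    have := leq_trans (rank_leq_col BL) (@card_layer d nu M r rM).
    have := rank_leq_row B; have := rank_leq_row BL; lia.
  move=> /row_subPn[i hi]; exists (row i (kermx BL)); split.
    by apply/sub_kermxP; exact: row_sub.
  by apply: contra hi => /eqP h; apply/sub_kermxP.
pose Psi y := \sum_i c ord0 i * psi i y.
have PsiB (x : X) : Psi (box_vertex x) = (c *m B) ord0 (enum_rank x).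
  by rewrite mxE; apply: eq_bigr => i _; rewrite mxE enum_rankK.
have PsiL (x : X) : x \in L -> Psi (box_vertex x) = 0.
  move=> xL; transitivity ((c *m BL) ord0 (enum_rank_in xL x)); last by rewrite cBL mxE.
  by rewrite mxE; apply: eq_bigr => i _; rewrite mxE enum_rankK_in.
have Psisol x : schrodinger G Psi x = lambda * Psi x.
  rewrite schrodinger_sum mulr_sumr; apply: eq_bigr => i _.
  by rewrite sol mulrCA.
(* Margins [2 r] and [r]: from a point of [mid] all neighbours stay in the box, where [Psi] vanishes
   off [core]; from any other point no neighbour is in [core]. In both cases the cut-off solves the
   equation. *)
pose core (n : 'rV[int]_d) := [forall i, ((2 * r)%:Z <= n ord0 i) && (n ord0 i + (2 * r)%:Z < M%:Z)].
pose mid (n : 'rV[int]_d) := [forall i, (r%:Z <= n ord0 i) && (n ord0 i + r%:Z < M%:Z)].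
have inbox (n : 'rV[int]_d) : (forall i, 0 <= n ord0 i < M%:Z) -> exists t : {ffun 'I_d -> 'I_M}, n = box_point t.
  move=> hn; have lt_n i : (`|n ord0 i| < M)%N by have := hn i; lia.
  exists [ffun i => Ordinal (lt_n i)]; apply/matrixP => i j; rewrite ord1 mxE ffunE /=.
  by rewrite gez0_abs//; have /andP[] := hn j.
have corePsi b (n : 'rV[int]_d) : (forall i, 0 <= n ord0 i < M%:Z) -> ~~ core n -> Psi (b, n) = 0.
  move=> /inbox[t ->] nc; rewrite -[(b, _)]/(box_vertex (b, t)); apply: PsiL.
  rewrite inE; apply: contra nc => /forallP h; apply/forallP => i.
  by rewrite mxE; have := h i; rewrite /=; lia.
pose phi (y : vtx) := if core y.2 then Psi y else 0.
have coremid (n : 'rV[int]_d) : core n -> mid n.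
  by move=> /forallP h; apply/forallP => i; have := h i; lia.
have arith1 (x y : int) : (`|y| <= r)%N ->
    ((2 * r)%:Z <= x + y) && (x + y + (2 * r)%:Z < M%:Z) -> (r%:Z <= x) && (x + r%:Z < M%:Z).
  by lia.
have arith2 (x y : int) : (`|y| <= r)%N ->
    (r%:Z <= x) && (x + r%:Z < M%:Z) -> 0 <= x + y < M%:Z.
  by lia.
have nbr (n k : 'rV[int]_d) : k \in s -> core (n + k) -> mid n.
  move=> ks /forallP h; apply/forallP => i; have := h i; rewrite mxE.
  exact: arith1 (hr k ks i).
have nbr2 (n k : 'rV[int]_d) : k \in s -> mid n -> forall i, 0 <= (n + k) ord0 i < M%:Z.
  move=> ks /forallP h i; have := h i; rewrite mxE.
  exact: arith2 (hr k ks i).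
have phisol x : schrodinger G phi x = lambda * phi x.
  case: x => a n; have [mn|nmn] := boolP (mid n).
    have phiPsi : phi (a, n) = Psi (a, n).
      rewrite /phi /=; case: ifPn => // nc; rewrite corePsi// => i.
      by have /forallP/(_ i) := mn; lia.
    rewrite phiPsi -Psisol; apply: eq_schrodinger => // b k ks.
    by rewrite /phi /=; case: ifPn => // nc; rewrite corePsi//; exact: nbr2.
  have phi0 : phi (a, n) = 0.
    by rewrite /phi /= ifN//; apply: contra nmn; exact: coremid.
  rewrite phi0 mulr0 -[RHS](schrodinger0 (a, n)); apply: eq_schrodinger => // b k ks.
  by rewrite /phi /= ifN//; apply: contra nmn; exact: nbr ks.
have phifin : finite_set [set x | phi x != 0].
  pose q := [seq box_vertex x | x <- enum {: X}].
  suff hs : [set x | phi x != 0] `<=` [set` q] by exact: sub_finite_set hs (finite_seq q).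
  move=> [b n] /=; rewrite /phi /=; case: ifPn => [cn _|]; last by rewrite eqxx.
  have [|t nt] := inbox n; first by move=> i; have /forallP/(_ i) := cn; lia.
  by apply/mapP; exists (b, t); rewrite ?mem_enum// /box_vertex /= -nt.
exists phi; split=> //; split.
  by split=> //; exact: l2_finite_support.
(* A nonzero value in the box cannot lie in the layer, so the cut-off keeps it. *)
have [j hj] : exists j, (c *m B) ord0 j != 0.
  by apply/rV0Pn.
have := PsiB (enum_val j); rewrite enum_valK => hP.
exists (box_vertex (enum_val j)); rewrite /phi ifT ?hP//.
apply/negP => /negP nc; have : enum_val j \in L.
  rewrite inE; apply: contra nc => /forallP h; apply/forallP => i.
  by rewrite mxE; have := h i; lia.
by move=> /PsiL; rewrite hP; apply/eqP.
Qed.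

End FiniteRange.

(** * From square-summable eigenvectors and flat bands to finite support *)

Section FiniteSupport.
Variables (R : realType) (d nu : nat) (G : periodic_graph R d nu).
Hypothesis lfG : locally_finite_graph G.
Local Notation C := R[i].
Local Notation vtx := (vertex d nu).

(* The matrix of the translates of [psi] by the points of a box, restricted to one
   vertex per cell of that box, has a constant diagonal and rows of bounded norm,
   so its rank is proportional to the volume of the box. *)
Lemma l2_eigenvector_finite_support lambda psi :
  eigenvector (schrodinger G) lambda psi ->
  exists phi, finite_support_eigenvector (schrodinger G) lambda phi.
Proof.
move=> [[/l2P[S hS] sol] [[a n0] nz]].
have [s [us ws]] := locally_finite_range lfG.
have [r hr] := range_bound s.
set p := nc (psi (a, n0)) ^+ 2.
have p0 : 0 < p by rewrite exprn_gt0// nc_gt0.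
have S0 : 0 < S.
  by apply: lt_le_trans p0 _; have := hS [:: (a, n0)] isT; rewrite big_seq1 sqnormE.
(* [p / S] is a lower bound for the rank of the matrix of translates divided by the volume
   [M ^ d]. *)
have [M [rM M0 small]] := @layer_small R d nu r (p / S) (divr_gt0 p0 S0).
pose T := ({ffun 'I_d -> 'I_M})%type.
have cT : #|{: T}| = (M ^ d)%N by rewrite card_ffun !card_ord.
(* The [i]-th translation carries the [i]-th point of the box to [n0], which makes the diagonal of
   [A] constant. *)
pose f (i : 'I_#|{: T}|) (y : vtx) := psi (y.1, y.2 + (n0 - box_point (enum_val i : T))).
have fsol i x : schrodinger G (f i) x = lambda * f i x.
  by case: x => b n; rewrite /f (schrodinger_translate us ws) sol.
apply: (truncate_solutions us ws hr rM fsol).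
set B := \matrix_(_, _) _.
pose A := \matrix_(i, j < #|{: T}|) f i (a, box_point (enum_val j : T)).
have AB : (\rank A <= \rank B)%N.
  have -> : A = colsub (fun j => enum_rank (a, enum_val j : T)) B.
    by apply/matrixP => i j; rewrite !mxE enum_rankK.
  by rewrite -{1}[B]mulmx1 -mulmx_colsub mxrankM_maxl.
have trA : \tr A = (M ^ d)%:R * psi (a, n0).
  rewrite /mxtrace (eq_bigr (fun=> psi (a, n0))) => [|i _]; last first.
    by rewrite mxE /f /= addrC subrK.
  by rewrite sumr_const card_ord cT mulr_natl.
(* Each row lists values of [psi] at distinct vertices, so its squares add up to at most [S]. *)
have HSA : \sum_i \sum_j nc (A i j) ^+ 2 <= (M ^ d)%:R * S.
  rewrite -cT -[in leRHS](card_ord #|{: T}|) mulr_natl -sumr_const; apply: ler_sum => i _.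
  pose q := [seq (a, box_point (enum_val j : T) + (n0 - box_point (enum_val i : T))) : vtx
             | j <- enum 'I_#|{: T}|].
  apply: (le_trans _ (hS q _)); last first.
    rewrite map_inj_uniq ?enum_uniq// => j j' [] /addIr h; apply: enum_val_inj.
    apply/ffunP => l; apply: val_inj; have /matrixP/(_ ord0 l) := h.
    by rewrite !mxE => -[].
  rewrite big_map big_enum /=; apply: ler_sum => j _.
  by rewrite mxE /f /= sqnormE.
have := le_trans (mxtrace_rank_bound A) (ler_wpM2l (ler0n _ _) HSA).
have V0 : (0 : R) < (M ^ d)%:R by rewrite ltr0n expn_gt0 M0.
rewrite trA ncM exprMn -/p.
have -> : nc ((M ^ d)%:R : C) = (M ^ d)%:R by rewrite -(rmorph_nat (real_complex R)) nc_real normr_nat.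
rewrite [X in X * p]expr2 -mulrA [leRHS]mulrCA ler_pM2l// => h.
rewrite -(ltr_nat R); apply: lt_le_trans small _.
rewrite mulrAC ler_pdivrMr// mulrC.
apply: (le_trans h); rewrite ler_pM2r// ler_nat//.
Qed.

(** The sum factors into geometric sums, one per coordinate; a coordinate where [t] and [t'] differ
    contributes the powers of an [M]-th root of unity other than [1]. *)
Lemma sum_box_characters M (t t' : {ffun 'I_d -> 'I_M}) : (0 < M)%N ->
  \sum_(n : {ffun 'I_d -> 'I_M})
     expi (2 * pi * (\sum_l (n l)%:R * (((t l)%:R - (t' l)%:R) / M%:R)) : R)
  = (M ^ d)%:R *+ (t == t').
Proof.
move=> M0.
have M0' : (M%:R : R) != 0 by rewrite pnatr_eq0 -lt0n.
pose z l : C := expi (2 * pi * (((t l)%:R - (t' l)%:R) / M%:R)).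
rewrite (eq_bigr (fun n : {ffun 'I_d -> 'I_M} => \prod_l z l ^+ n l)); last first.
  move=> n _; rewrite mulr_sumr expi_sum; apply: eq_bigr => l _.
  by rewrite mulrCA expiX.
rewrite -(bigA_distr_bigA (fun l (j : 'I_M) => z l ^+ j)).
have [tt'|/eqP tt'] := eqVneq t t'.
  rewrite (eq_bigr (fun=> M%:R)); first by rewrite prodr_const card_ord natrX.
  move=> l _; rewrite (eq_bigr (fun=> 1)) ?sumr_const ?card_ord// => j _.
  by rewrite /z tt' subrr mul0r mulr0 expi0 expr1n.
have [l tl] : exists l, t l != t' l.
  apply/existsP; rewrite -negb_forall; apply/negP => /forallP h.
  by apply: tt'; apply/ffunP => l; apply/eqP.
rewrite mulr0n (bigD1 l)//=; apply/eqP; rewrite mulf_eq0; apply/orP; left.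
have z1 : z l != 1.
  apply: expi_neq1; rewrite normr_gt0 mulf_neq0 ?invr_eq0//=; last first.
    by rewrite subr_eq0 eqr_nat.
  rewrite normrM normfV normr_nat ltr_pdivrMr ?ltr0n// mul1r.
  have := ltn_ord (t l); have := ltn_ord (t' l).
  rewrite -!(ltr_nat R); have := ler0n R (t l); have := ler0n R (t' l).
  by move: (_%:R) (_%:R) => x y; rewrite ltr_norml; lra.
have : (z l - 1) * (\sum_(j < M) z l ^+ j) = 0.
  rewrite -subrX1 -expiX mulrCA (mulrC _ (_ / _)) divfK// mulrBr expiD expiN.
  by rewrite !expi_2pi_nat invr1 mulr1 subrr.
by move=> /eqP; rewrite mulf_eq0 subr_eq0 (negbTE z1).
Qed.

(** Moving by [k] multiplies the plane wave by [expi (2 * pi * dot k theta)], which is absorbed into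
    the Floquet matrix. *)
Lemma bloch_solution lambda theta (u : 'cV[C]_nu) :
  floquet G theta *m u = lambda *: u ->
  forall x : vtx, schrodinger G (fun y => u y.1 0 * expi (2 * pi * dot y.2 theta)) x =
    lambda * (u x.1 0 * expi (2 * pi * dot x.2 theta)).
Proof.
have [s [us ws]] := locally_finite_range lfG.
move=> /matrixP hu [a n]; have := hu a 0; rewrite !mxE /= mulrA => <-.
rewrite (schrodingerE us ws) /= mulr_suml.
transitivity (\sum_b (\sum_(k <- s) (weight G a b k)%:C * expi (2 * pi * dot k theta)) *
     u b 0 * expi (2 * pi * dot n theta) + (potential G a)%:C * u a 0 * expi (2 * pi * dot n theta)).
  rewrite mulrA; congr (_ + _); apply: eq_bigr => b _; rewrite !mulr_suml.
  by apply: eq_bigr => k _; rewrite dotDl mulrDr expiD; ring.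
transitivity (\sum_b ((\sum_(k <- s) (weight G a b k)%:C * expi (2 * pi * dot k theta)) *
     u b 0 * expi (2 * pi * dot n theta) +
   (potential G a)%:C *+ (a == b) * u b 0 * expi (2 * pi * dot n theta))).
  rewrite big_split /=; congr (_ + _).
  rewrite (bigD1 a)//= eqxx big1 ?addr0// => b; rewrite eq_sym => /negbTE ->.
  by rewrite mulr0n !mul0r.
by apply: eq_bigr => b _; rewrite (floquetE us ws) -mulrDl -mulrDl.
Qed.

(** [eigenvalue] speaks of row vectors, whereas Bloch waves need a column; singularity passes to the
    transpose. *)
Lemma eigenvalue_colvec n (A : 'M[C]_n) lambda : eigenvalue A lambda ->
  exists u : 'cV[C]_n, A *m u = lambda *: u /\ u != 0.
Proof.
rewrite /eigenvalue /eigenspace kermx_eq0 row_free_unit -unitmx_tr -row_free_unit -kermx_eq0.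
move=> /rowV0Pn[v /sub_kermxP hv v0]; exists v^T; split; last by rewrite trmx_eq0.
apply/eqP; rewrite -subr_eq0 -mul_scalar_mx -mulmxBl -trmx_eq0 trmx_mul trmxK.
by rewrite hv.
Qed.

Lemma flat_band_finite_support lambda : flat_band G lambda ->
  exists phi, finite_support_eigenvector (schrodinger G) lambda phi.
Proof.
move=> flat.
have [s [us ws]] := locally_finite_range lfG.
have [r hr] := range_bound s.
have [M [rM M0 small]] := @layer_small R d nu r (1 : R) ltr01.
pose T := ({ffun 'I_d -> 'I_M})%type.
have cT : #|{: T}| = (M ^ d)%N by rewrite card_ffun !card_ord.
(* The [M ^ d] quasi-momenta in [(1/M) Z^d], whose characters are orthogonal on the box. *)
pose th (t : T) : 'rV[R]_d := \row_l ((t l)%:R / M%:R).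
have /choice[u hu] (t : T) : exists u : 'cV[C]_nu, floquet G (th t) *m u = lambda *: u /\ u != 0.
  exact: eigenvalue_colvec (flat (th t)).
pose f (i : 'I_#|{: T}|) (y : vtx) :=
  u (enum_val i) y.1 0 * expi (2 * pi * dot y.2 (th (enum_val i))).
apply: (truncate_solutions us ws hr rM (psi := f)).
  by move=> i x; apply: bloch_solution; exact: (hu _).1.
set B := \matrix_(_, _) _.
suff -> : \rank B = #|{: T}| by rewrite cT -(ltr_nat R) -[ltRHS]mul1r.
apply/eqP; rewrite -/(row_free B); apply: inj_row_free => c cB.
apply/matrixP => i j; rewrite ord1 {i} [RHS]mxE.
have [b ub] : exists b, u (enum_val j) b 0 != 0.
  have := (hu (enum_val j)).2; rewrite -trmx_eq0 => /rV0Pn[b].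
  by rewrite mxE => h; exists b.
have eqn (n : T) : \sum_i c 0 i * f i (b, box_point n) = 0.
  transitivity ((c *m B) 0 (enum_rank (b, n))); last by rewrite cB mxE.
  by rewrite mxE; apply: eq_bigr => i _; rewrite mxE enum_rankK.
(* Pairing with the conjugate of the [j]-th character isolates the coefficient of the [j]-th wave,
   in a component [b] where its amplitude is not zero. *)
have : \sum_(n : T) expi (- (2 * pi * dot (box_point n) (th (enum_val j)))) *
    (\sum_i c 0 i * f i (b, box_point n)) = 0.
  by apply: big1 => n _; rewrite eqn mulr0.
under eq_bigr do rewrite mulr_sumr.
rewrite exchange_big /= (eq_bigr (fun i => c 0 i * u (enum_val i) b 0 *
   ((M ^ d)%:R *+ (enum_val i == enum_val j)))) => [|i _]; last first.
  rewrite -(sum_box_characters _ _ M0) mulr_sumr; apply: eq_bigr => n _.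
  rewrite /f /= mulrCA (mulrCA (expi _)) mulrA; congr (_ * _).
  rewrite mulrC -expiD; congr expi; rewrite -mulrBr; congr (_ * _).
  rewrite /dot -sumrB; apply: eq_bigr => l _; rewrite !mxE /=; ring.
rewrite (bigD1 j)//= eqxx big1 ?addr0 => [|i ij]; last first.
  by rewrite (inj_eq enum_val_inj) (negbTE ij) mulr0n mulr0.
move=> /eqP; rewrite !mulf_eq0 (negbTE ub) orbF.
by rewrite mulr1n pnatr_eq0 expn_eq0 (gtn_eqF M0) orbF => /eqP.
Qed.

End FiniteSupport.

(** * Graphs with one vertex per cell *)

Lemma seq_argmax (T : eqType) (f : T -> int) (s : seq T) x0 : x0 \in s ->
  exists2 x, x \in s & forall y, y \in s -> f y <= f x.
Proof.
elim: s x0 => // a s IH x0 _; case: s IH => [_|b s IH].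
  by exists a; rewrite ?mem_head// => y; rewrite inE => /eqP ->.
have [x xs hx] := IH b (mem_head _ _).
have [h|h] := leP (f a) (f x).
  exists x; first by rewrite inE xs orbT.
  by move=> y; rewrite inE => /predU1P[->//|]; exact: hx.
exists a; first exact: mem_head.
move=> y; rewrite inE => /predU1P[->//|/hx h']; exact: le_trans h' (ltW h).
Qed.

(* The powers of a non-root of a product of polynomials define the functional. *)
Lemma separating_functional d (F : seq 'rV[int]_d) : 0 \notin F ->
  exists l : 'rV[int]_d -> int, (forall u v, l (u + v) = l u + l v) /\
    forall v, v \in F -> l v != 0.
Proof.
move=> F0; pose q (v : 'rV[int]_d) : {poly int} := \poly_(i < d) (if insub i is Some j then v ord0 j else 0).
have q0 v : v \in F -> q v != 0.
  move=> vF; have /rV0Pn[j vj] : v != 0 by apply: contraNneq F0 => <-.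
  apply/eqP => /polyP/(_ j); rewrite coef_poly ltn_ord coef0 valK.
  by move=> h; rewrite h eqxx in vj.
pose P := \prod_(v <- F) q v.
have P0 : P != 0 by rewrite prodf_seq_neq0; apply/allP => v /q0.
have [B hB] : exists B : int, ~~ root P B.
  pose rs := [seq n%:Z | n <- iota 0 (size P)].
  have : ~~ all (root P) rs.
    apply/negP => h; have := max_poly_roots P0 h.
    by rewrite map_inj_uniq ?iota_uniq ?size_map ?size_iota ?ltnn => [/(_ isT)|x y []].
  by move=> /allPn[B _ hB]; exists B.
exists (fun v => (q v).[B]); split.
  move=> u v; rewrite -hornerD; congr (_.[_]); apply/polyP => i.
  rewrite coefD !coef_poly; case: ifP => [id|]; last by rewrite addr0.
  by rewrite insubT mxE.
move=> v vF; apply: contra hB; rewrite /root horner_prod prodf_seq_eq0 => h.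
by apply/hasP; exists v.
Qed.

Lemma no_finite_support_one_vertex (R : realType) d (G : periodic_graph R d 1) lambda :
  (0 < d)%N -> connected_graph G -> locally_finite_graph G ->
  ~ exists phi, finite_support_eigenvector (schrodinger G) lambda phi.
Proof.
move=> d0 cG lfG [phi [[[_ sol] [[a0 m0] nz]] fin]].
have [s [us ws]] := locally_finite_range lfG.
pose w k := weight G ord0 ord0 k.
(* Connectedness with [0 < d] forces an edge: a path from [0] to the all-ones vector is not
   empty. *)
have [k0 k00 wk0] : exists2 k, k != 0 & w k != 0.
  have [p [pp lp]] := cG (ord0, 0) (ord0, const_mx 1).
  case: p pp lp => [_ [] /matrixP/(_ 0 (Ordinal d0))|[b k] p /= /andP[]].
    by rewrite !mxE.
  rewrite /Defs.adjacent /edge_weight /= subr0 (ord1 b) => wk _ _; exists k => //.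
  by apply: contraNneq wk => ->; rewrite weight_loopless.
have wN k : w (- k) = w k by rewrite /w weight_sym opprK.
pose s' := [seq k <- s | w k != 0].
have s'P k : (k \in s') = (w k != 0).
  by rewrite mem_filter; apply: andb_idr => /ws.
pose F := [seq u - v | u <- s', v <- s'].
have F0 : 0 \notin [seq x <- F | x != 0] by rewrite mem_filter eqxx.
have [l [lD lF]] := separating_functional F0.
have lB u v : l (u - v) = l u - l v.
  by apply/eqP; rewrite -subr_eq opprK -lD subrK.
have linj u v : u \in s' -> v \in s' -> l u = l v -> u = v.
  move=> us' vs' luv; apply/eqP; rewrite -subr_eq0; apply/negP => /negP uv.
  have : l (u - v) != 0.
    by apply: lF; rewrite mem_filter uv; apply/allpairsP; exists (u, v).
  by rewrite lB luv subrr eqxx.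
have k0s' : k0 \in s' by rewrite s'P.
have [K Ks' Kmax] := seq_argmax l k0s'.
(* The support of [w] is symmetric, and [l] is not zero at [k0] because it separates [k0] from
   [- k0]. *)
have lK : 0 < l K.
  have l0 : l 0 = 0 by have := lB 0 0; rewrite !subrr.
  have lN : l (- k0) = - l k0 by rewrite -sub0r lB l0 sub0r.
  have h1 := Kmax k0; have h2 := Kmax (- k0).
  rewrite !s'P wN wk0 lN in h1 h2.
  have : l k0 != 0.
    apply/eqP => h; have : k0 = - k0.
      by apply: linj; rewrite ?s'P ?wN// lN h oppr0.
    move=> /eqP; rewrite -subr_eq0 opprK => /eqP e; move/eqP: k00; apply.
    apply/matrixP => i j; have /matrixP/(_ i j) := e; rewrite !mxE.
    by move: (k0 i j) => x; lia.
  by move: (h1 isT) (h2 isT); lia.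
have /finite_seqP[p hp] := fin.
have pP m : (m \in p) = (phi m != 0).
  apply/idP/idP => [h|h].
    have : [set` p] m by [].
    by rewrite -hp.
  have : [set x | phi x != 0] m by [].
  by rewrite hp.
have m0p : (a0, m0) \in p by rewrite pP.
have [[a N] Np Nmin] := seq_argmax (fun m => - l m.2) m0p.
have phi0 m : l m < l N -> phi (ord0, m) = 0.
  move=> h; apply/eqP; apply/negP => /negP; rewrite -pP => /Nmin /=.
  by rewrite lerN2 leNgt h.
(* [N] minimises [l] on the support of [phi]. The neighbour [N - K + k] has value [l N - l K + l k],
   below that minimum for every [k] in the support of [w] except [K]; only the nonzero term
   [w K * phi N] survives. *)
have := sol (ord0, N - K); rewrite (schrodingerE us ws) big_ord1 /=.
rewrite (phi0 (N - K)) ?lB ?ltrBlDr ?ltrDl// !mulr0 addr0 => /eqP.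
rewrite (bigD1_seq K) ?(ws _ _ _ _)//=; last by move: Ks'; rewrite mem_filter => /andP[].
rewrite subrK big1 ?addr0 => [|k kK].
  rewrite mulf_eq0 -[weight _ _ _ K]/(w K); move: Ks' Np; rewrite s'P pP (ord1 a).
  by rewrite -(rmorph0 (real_complex R)) (inj_eq (@complexI R)) => /negbTE -> /negbTE ->.
have [->|wk] := eqVneq (weight G ord0 ord0 k) 0; first by rewrite mul0r.
rewrite phi0 ?mulr0// lD lB -addrA gtrDl addrC subr_lt0 lt_neqAle Kmax ?s'P// andbT.
apply: contra kK => /eqP h; apply/eqP; apply: linj => //; by rewrite s'P.
Qed.

(** * The graph Gamma *)

Section RealEstimates.
Variable R : realType.

(** Identities between infinite sums are obtained in this form, from O(1/N) estimates on partial
    sums. *)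
Lemma eq_of_dist_le_inv (a b K : R) :
  (forall N, (0 < N)%N -> `|a - b| <= K / N%:R) -> a = b.
Proof.
move=> h; apply/eqP; rewrite -subr_eq0 -normr_eq0; apply/negP => /negP ab.
have ab0 : 0 < `|a - b| by rewrite lt_def ab normr_ge0.
have := h (Num.truncn (K / `|a - b|)).+1 isT.
rewrite leNgt => /negP; apply; rewrite ltr_pdivrMr ?ltr0n// mulrC -ltr_pdivrMr//.
exact: truncnS_gt.
Qed.

(** Telescoping: [C / (k+2)^2 <= C / (k+1) - C / (k+2)]. *)
Lemma series_tail (v : nat -> R) (C : R) :
  (forall k, `|v k| <= C / k.+1%:R ^+ 2) ->
  cvgn (series v) /\ forall N, (0 < N)%N -> `|limn (series v) - series v N| <= C / N%:R.
Proof.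
move=> hv.
have C0 : 0 <= C by have := hv 0%N; rewrite expr1n divr1; apply: le_trans.
have stepC (k : nat) : C / k.+2%:R ^+ 2 <= C / k.+1%:R - C / k.+2%:R.
  rewrite -mulrBr ler_wpM2l//.
  have k1 : (0 : R) < k.+1%:R by rewrite ltr0n.
  have k2 : (0 : R) < k.+2%:R by rewrite ltr0n.
  have -> : k.+1%:R^-1 - k.+2%:R^-1 = (k.+1%:R * k.+2%:R)^-1 :> R.
    have e : k.+2%:R = k.+1%:R + 1 :> R by rewrite natr1.
    by move: k1 k2; rewrite e => k1 k2; field; rewrite !lt0r_neq0.
  by rewrite lef_pV2 ?posrE ?mulr_gt0 ?exprn_gt0// expr2 ler_wpM2r ?ler_nat// ltW.
(* Stated for any [u], as it serves both [v] and the series of absolute values. *)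
have tail (u : nat -> R) : (forall k, `|u k| <= C / k.+1%:R ^+ 2) -> forall N m,
    `|series u (N.+1 + m)%N - series u N.+1| <= C / N.+1%:R - C / (N.+1 + m)%:R.
  move=> hu N; elim=> [|m IH]; first by rewrite addn0 !subrr normr0.
  rewrite addnS seriesSr addrAC; apply: (le_trans (ler_normD _ _)).
  apply: (le_trans (lerD IH (hu _))); rewrite addSn.
  by apply: (le_trans (lerD (lexx _) (stepC (N + m)%N))); rewrite addrA subrK.
have cv : cvgn (series v).
  apply: normed_cvg; apply: nondecreasing_is_cvgn.
    by apply: nondecreasing_series => k _ _; exact: normr_ge0.
  exists (`|v 0%N| + C) => _ [n _ <-].
  have hn k : `| (`|v k|) | <= C / k.+1%:R ^+ 2 by rewrite normr_id.
  case: n => [|n]; first by rewrite [leLHS](_ : _ = 0) ?addr_ge0//; exact: big_geq.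
  have := tail _ hn 0%N n; rewrite add1n divr1.
  rewrite (_ : series (fun k => `|v k|) 1%N = `|v 0%N|); last by rewrite /series /= big_nat1.
  move=> /ler_normlP[_]; rewrite lerBlDl => h; apply: le_trans h _.
  by rewrite lerD2l gerBl divr_ge0.
split=> // -[//|N] _.
have near_tail (K : R) : (forall m, series v (N.+1 + m)%N <= K) -> limn (series v) <= K.
  move=> h; apply: limr_le => //; exists N.+1 => // n /= Nn.
  by rewrite -(subnKC Nn).
have near_tail2 (K : R) : (forall m, K <= series v (N.+1 + m)%N) -> K <= limn (series v).
  move=> h; apply: limr_ge => //; exists N.+1 => // n /= Nn.
  by rewrite -(subnKC Nn).
have tl m : `|series v (N.+1 + m)%N - series v N.+1| <= C / N.+1%:R.
  by apply: (le_trans (tail v hv N m)); rewrite gerBl divr_ge0.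
rewrite ler_norml lerBlDr lerBrDr; apply/andP; split.
  by apply: near_tail2 => m; have := tl m; rewrite ler_norml lerBlDr lerBrDr => /andP[].
by apply: near_tail => m; have := tl m; rewrite ler_norml lerBlDr lerBrDr => /andP[].
Qed.

(** Partial sum over [|k| <= N]. As [Negz k] is [- (k + 1)], opposite indices are paired, so odd
    parts cancel before any limit is taken. *)
Definition symsum (u : int -> R) (N : nat) : R :=
  u 0 + \sum_(0 <= k < N) (u (Posz k.+1) + u (Negz k)).

(** Each of the two half-series contributes a tail of at most [C / N]; the term at [0] is split off
    the nonnegative half. *)
Lemma zsum_approx (u : int -> R) (C : R) :
  (forall k, k != 0 -> `|u k| <= C / k%:~R ^+ 2) ->
  forall N, (0 < N)%N -> `|zsum u - symsum u N| <= 2 * C / N%:R.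
Proof.
move=> hu N N0.
have [cP tP] : cvgn (series (fun k => u (Posz k.+1))) /\ forall N, (0 < N)%N ->
    `|limn (series (fun k => u (Posz k.+1))) - series (fun k => u (Posz k.+1)) N| <= C / N%:R.
  by apply: series_tail => k; exact: hu.
have [cN tN] : cvgn (series (fun k => u (Negz k))) /\ forall N, (0 < N)%N ->
    `|limn (series (fun k => u (Negz k))) - series (fun k => u (Negz k)) N| <= C / N%:R.
  by apply: series_tail => k; have := hu (Negz k) isT; rewrite NegzE intrN sqrrN.
have sE : limn (series (fun k => u (Posz k))) = u 0 + limn (series (fun k => u (Posz k.+1))).
  apply: cvg_lim => //; rewrite -cvg_shiftS.
  rewrite (_ : (fun n => _) = (fun n => u 0 + series (fun k => u (Posz k.+1)) n)).
    by apply: cvgD => //; exact: cvg_cst.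
  by apply/funext => n; rewrite /series /= big_nat_recl.
rewrite /zsum sE /symsum big_split /=.
have := tP N N0; have := tN N N0; rewrite /series /= => h1 h2.
rewrite (_ : _ - _ = (limn (series (fun k : nat => u k.+1)) - \sum_(0 <= i < N) u i.+1) +
   (limn (series (fun k : nat => u (Negz k))) - \sum_(0 <= k < N) u (Negz k))); last by ring.
by apply: (le_trans (ler_normD _ _)); have := lerD h2 h1; lra.
Qed.

End RealEstimates.

Section Derivatives.
Variable R : realType.

Lemma is_derive_cosM (c k p x : R) :
  is_derive x (1 : R) (fun t : R => c * cos (k * t + p)) (- (c * k * sin (k * x + p))).
Proof.
have h : is_derive x (1 : R) (fun t : R => k * t + p) (k * 1 + 0).
  exact: (@is_deriveD _ _ _ (k *: (id : R -> R)) (cst p) x 1 _ _ _ _).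
have h2 := @is_derive1_comp _ cos (fun t => k * t + p) x _ _ _ h.
have h3 := @is_deriveZ _ _ _ _ c x 1 _ (h2 _ (is_derive_cos _)).
apply: (@is_derive_eq _ _ _ _ _ _ _ _ h3).
by rewrite addr0 /GRing.scale /=; ring.
Qed.

Lemma is_derive_sinM (c k p x : R) :
  is_derive x (1 : R) (fun t : R => c * sin (k * t + p)) (c * k * cos (k * x + p)).
Proof.
have -> : (fun t => c * sin (k * t + p)) = (fun t => c * cos (k * t + (p - pi / 2))).
  by apply/funext => t; rewrite addrA cosBpihalf.
apply: (@is_derive_eq _ _ _ _ _ _ _ _ (is_derive_cosM c k (p - pi / 2) x)).
by rewrite addrA sinBpihalf; ring.
Qed.

Lemma is_derive_cosM0 (c k x : R) :
  is_derive x (1 : R) (fun t : R => c * cos (k * t)) (- (c * k * sin (k * x))).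
Proof.
have := is_derive_cosM c k 0 x; rewrite addr0.
by rewrite (_ : (fun t => _) = (fun t : R => c * cos (k * t)))//; apply/funext => t; rewrite addr0.
Qed.

Lemma is_derive_sinM0 (c k x : R) :
  is_derive x (1 : R) (fun t : R => c * sin (k * t)) (c * k * cos (k * x)).
Proof.
have := is_derive_sinM c k 0 x; rewrite addr0.
by rewrite (_ : (fun t => _) = (fun t : R => c * sin (k * t)))//; apply/funext => t; rewrite addr0.
Qed.

Lemma is_derive_bigsum (n : nat) (h dh : nat -> R -> R) (x : R) :
  (forall i, is_derive x (1 : R) (h i) (dh i x)) ->
  is_derive x (1 : R) (fun t : R => \sum_(0 <= i < n) h i t) (\sum_(0 <= i < n) dh i x).
Proof.
move=> H; elim: n => [|n IH].
  rewrite big_geq//; rewrite (_ : (fun t => _) = cst 0); first exact: is_derive_cst.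
  by apply/funext => t; rewrite big_geq.
rewrite big_nat_recr//= (_ : (fun t => _) = (fun t => \sum_(0 <= i < n) h i t) + h n).
  exact: is_deriveD.
by apply/funext => t; rewrite big_nat_recr.
Qed.

End Derivatives.

(** * The flat piece of the band *)

Section GammaBand.
Variable R : realType.
Local Notation w := (@gamma_weight R).

Lemma gamma_weight_nat (n : nat) : w n =
  if (4 %| n)%N then 0 else if (2 %| n)%N then 2 / n%:R ^+ 2 else n%:R ^- 2.
Proof. by []. Qed.

Lemma gamma_weightN (k : int) : w (- k) = w k.
Proof. by rewrite /gamma_weight !dvdzE abszN intrN sqrrN. Qed.

Lemma gamma_weight0 : w 0 = 0. Proof. by []. Qed.

Lemma gamma_weight_bound k : `|w k| <= 2 / k%:~R ^+ 2.
Proof.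
have h : 0 <= (k%:~R ^- 2 : R) by rewrite invr_ge0 sqr_ge0.
rewrite /gamma_weight; case: ifP => _; first by rewrite normr0 mulr_ge0.
case: ifP => _; first by rewrite ger0_norm ?mulr_ge0.
by rewrite ger0_norm//; lra.
Qed.

Lemma gamma_weight_ge0 k : 0 <= w k.
Proof.
have h : 0 <= (k%:~R ^- 2 : R) by rewrite invr_ge0 sqr_ge0.
by rewrite /gamma_weight; do 2 case: ifP => _ //; rewrite mulr_ge0.
Qed.

Definition odd_cos_sum (M : nat) (x : R) : R :=
  \sum_(0 <= i < M) (i.*2.+1)%:R ^- 2 * cos ((i.*2.+1)%:R * x).

Definition odd_sin_sum (M : nat) (x : R) : R :=
  \sum_(0 <= i < M) (i.*2.+1)%:R^-1 * sin ((i.*2.+1)%:R * x).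

Lemma is_derive_odd_cos_sum M (x : R) :
  is_derive x (1 : R) (odd_cos_sum M) (- odd_sin_sum M x).
Proof.
have D := is_derive_bigsum M (fun i => is_derive_cosM0 (i.*2.+1%:R ^- 2) i.*2.+1%:R x)
  (dh := fun i x => - (i.*2.+1%:R ^- 2 * i.*2.+1%:R * sin (i.*2.+1%:R * x))).
apply: (@is_derive_eq _ _ _ _ _ _ _ _ D).
rewrite /odd_sin_sum -sumrN; apply: eq_bigr => i _; congr (- (_ * _)).
have : i.*2.+1%:R != 0 :> R by rewrite pnatr_eq0.
by move: (i.*2.+1%:R : R) => q q0; field.
Qed.

Lemma is_derive_odd_sin_sum M (x : R) :
  is_derive x (1 : R) (odd_sin_sum M) (\sum_(0 <= i < M) cos ((i.*2.+1)%:R * x)).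
Proof.
have D := is_derive_bigsum M (fun i => is_derive_sinM0 (i.*2.+1%:R^-1) i.*2.+1%:R x)
  (dh := fun i x => i.*2.+1%:R^-1 * i.*2.+1%:R * cos (i.*2.+1%:R * x)).
apply: (@is_derive_eq _ _ _ _ _ _ _ _ D).
by apply: eq_bigr => i _; rewrite mulVf ?mul1r// pnatr_eq0.
Qed.

(** Telescoping: [2 sin x cos ((2i+1) x) = sin ((2i+2) x) - sin (2i x)]. *)
Lemma sin_odd_cos_sum M (x : R) :
  2 * sin x * \sum_(0 <= i < M) cos ((i.*2.+1)%:R * x) = sin ((M.*2)%:R * x).
Proof.
elim: M => [|M IH]; first by rewrite big_geq// mulr0 mul0r sin0.
rewrite big_nat_recr//= mulrDr IH doubleS.
have -> : (M.*2.+2)%:R * x = (M.*2.+1)%:R * x + x by rewrite -natr1 mulrDl mul1r.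
have -> : (M.*2)%:R * x = (M.*2.+1)%:R * x - x by rewrite -[in RHS]natr1 mulrDl mul1r addrK.
by rewrite sinB sinD; ring.
Qed.

Lemma sqr_sin_ge_half (t : R) : pi / 4 <= t <= 3 * pi / 4 -> 2^-1 <= sin t ^+ 2.
Proof.
move=> /andP[t1 t2].
have e : cos (t *+ 2) = 1 - 2 * sin t ^+ 2 by rewrite cos_mulr2n cos2sin2; ring.
have e2 : cos (t *+ 2) = - sin (t *+ 2 - pi / 2) by rewrite -cosDpihalf subrK.
have : 0 <= sin (t *+ 2 - pi / 2).
  by apply: sin_ge0_pi; apply/andP; split; rewrite mulr2n; lra.
lra.
Qed.

(* Adding [cos (2 M t) / (4 M sin t)] cancels the oscillating derivative
   [sin (2 M t) / (2 sin t)] of the sine sum up to O(1/M). *)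
Lemma odd_sin_sum_near_const M (y z : R) : (0 < M)%N ->
  pi / 4 <= y <= 3 * pi / 4 -> pi / 4 <= z <= 3 * pi / 4 ->
  `|odd_sin_sum M y - odd_sin_sum M z| <= 2 / M%:R.
Proof.
move=> M0; wlog zy : y z / z <= y => [h hy hz|hy hz].
  by case: (leP z y) => [zy|/ltW yz]; [exact: h|rewrite distrC; exact: h].
have m0 : (0 : R) < M%:R by rewrite ltr0n.
set m : R := M%:R in m0 *.
have sin_half (t : R) : pi / 4 <= t <= 3 * pi / 4 -> 2^-1 <= sin t.
  move=> ht; have := sqr_sin_ge_half ht.
  have : 0 <= sin t by apply: sin_ge0_pi; have := pi_gt0 R; move/andP: ht => [? ?] ?; apply/andP; split; lra.
  have := sin_le1 t; nra.
have m4 : 0 <= (4 * m)^-1 by rewrite invr_ge0 mulr_ge0 // ltW.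
have m2 : 0 <= (2 * m)^-1 by rewrite invr_ge0 mulr_ge0 // ltW.
pose corr (t : R) := (4 * m)^-1 * cos ((M.*2)%:R * t) * (sin t)^-1.
have corr_le (t : R) : pi / 4 <= t <= 3 * pi / 4 -> `|corr t| <= (2 * m)^-1.
  move=> ht; have s2 := sin_half t ht; have s0 : 0 < sin t by lra.
  rewrite /corr !normrM (ger0_norm m4) (ger0_norm (_ : 0 <= (sin t)^-1)); last first.
    by rewrite invr_ge0 ltW.
  have i2 : (sin t)^-1 <= 2 by rewrite -[leRHS]invrK lef_pV2// posrE; lra.
  have -> : (2 * m)^-1 = (4 * m)^-1 * 1 * 2 by field; rewrite lt0r_neq0.
  apply: ler_pM => //; first exact: mulr_ge0.
    by rewrite invr_ge0 ltW.
  by rewrite ler_wpM2l// cos_max.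
(* What is left of the derivative after the terms [sin (2 M t) / (2 sin t)] have cancelled. *)
pose dcorr (t : R) := - cos ((M.*2)%:R * t) * cos t / (4 * m * sin t ^+ 2).
have dr (t : R) : pi / 4 <= t <= 3 * pi / 4 ->
    is_derive t (1 : R) (fun u : R => odd_sin_sum M u + corr u) (dcorr t).
  move=> ht; have s2 := sin_half t ht; have s0 : sin t != 0 by rewrite gt_eqF//; lra.
  have d1 := is_derive_odd_sin_sum M t.
  have d2 := @is_derive_cosM0 R (4 * m)^-1 (M.*2)%:R t.
  have d3 := @is_deriveV _ _ _ _ _ s0 (is_derive_sin t).
  have d4 := @is_deriveM _ _ _ _ _ _ _ _ d2 d3.
  apply: (@is_derive_eq _ _ _ _ _ _ _ _ (@is_deriveD _ _ _ _ _ _ _ _ _ d1 d4)).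
  have e := sin_odd_cos_sum M t.
  have -> : \sum_(0 <= i < M) cos ((i.*2.+1)%:R * t) = sin ((M.*2)%:R * t) / (2 * sin t).
    by rewrite -e mulrC mulKf// mulf_neq0.
  rewrite /dcorr /GRing.scale /= -mul2n natrM -/m; field.
  by rewrite s0 lt0r_neq0.
have dcorr_le (t : R) : pi / 4 <= t <= 3 * pi / 4 -> `|dcorr t| <= (2 * m)^-1.
  move=> ht; have s2 := sqr_sin_ge_half ht.
  have s0 : 0 < sin t ^+ 2 by lra.
  have m4s : 0 < 4 * m * sin t ^+ 2 by apply: mulr_gt0 => //; exact: mulr_gt0.
  rewrite /dcorr normrM normrM normrN (ger0_norm (_ : 0 <= (4 * m * sin t ^+ 2)^-1)); last first.
    by rewrite invr_ge0 ltW.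
  rewrite -[leRHS]mul1r; apply: ler_pM; rewrite ?mulr_ge0 ?invr_ge0 ?(ltW m4s)//.
    by rewrite -[leRHS]mul1r; apply: ler_pM => //; exact: cos_max.
  rewrite lef_pV2 ?posrE//; last exact: mulr_gt0.
  have -> : 2 * m = 4 * m * 2^-1 by field.
  by rewrite ler_wpM2l// mulr_ge0// ltW.
have D : `|(odd_sin_sum M y + corr y) - (odd_sin_sum M z + corr z)| <= (2 * m)^-1 * (y - z).
  have btw t : z <= t <= y -> pi / 4 <= t <= 3 * pi / 4.
    by move=> /andP[t1 t2]; move/andP: hy => [? ?]; move/andP: hz => [? ?]; apply/andP; split; lra.
  by apply: (norm_mean_value zy (fun t ht => dr t (btw t ht)) (fun t ht => dcorr_le t (btw t ht))).
have c1 := corr_le y hy; have c2 := corr_le z hz.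
have yz : y - z <= 2.
  by have := pihalf_lt2 R; move/andP: hy => [? ?]; move/andP: hz => [? ?]; lra.
have D2 : (2 * m)^-1 * (y - z) <= m^-1.
  have -> : m^-1 = (2 * m)^-1 * 2 by field; rewrite lt0r_neq0.
  by rewrite ler_wpM2l.
(* [1/m] bounds the corrected difference, as [y - z <= 2]; each of the two corrections costs
   [1/(2m)]. *)
have -> : 2 / m = m^-1 + (2 * m)^-1 + (2 * m)^-1 by field; rewrite lt0r_neq0.
rewrite (_ : _ - _ = (odd_sin_sum M y + corr y - (odd_sin_sum M z + corr z)) - corr y + corr z); last by ring.
apply: (le_trans (ler_normD _ _)); apply: lerD => //.
apply: (le_trans (ler_normB _ _)); apply: lerD => //.
exact: le_trans D D2.
Qed.

(** Odd frequencies change sign under a shift by [pi]. This brings [2x] into the range where the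
    sine sum is nearly constant. *)
Lemma odd_sin_sum_reflect M (x : R) : odd_sin_sum M (2 * x) = - odd_sin_sum M (2 * x - pi).
Proof.
rewrite /odd_sin_sum -sumrN; apply: eq_bigr => i _; rewrite -mulrN; congr (_ * _).
rewrite mulrBr; set y := _ * (2 * x).
have -> : (i.*2.+1)%:R * pi = pi + pi *+ 2 *+ i :> R.
  by rewrite -mulrnA mul2n -(mulr_natl pi) -natr1 mulrDl mul1r addrC.
rewrite -[in LHS](subrK (pi + pi *+ 2 *+ i) y) addrA.
by rewrite (periodicn (@sinD2pi R)) sinDpi.
Qed.

(** The interval consists of the [x] for which [x] and [2x - pi] both lie between [pi/4] and
    [3 pi/4], so that the two sine sums in the derivative nearly cancel. *)
Lemma gamma_partial_sum_near_const M (x y : R) : (0 < M)%N ->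
  5 * pi / 8 <= x <= 3 * pi / 4 -> 5 * pi / 8 <= y <= 3 * pi / 4 ->
  `|(2 * odd_cos_sum M x + odd_cos_sum M (2 * x)) -
    (2 * odd_cos_sum M y + odd_cos_sum M (2 * y))| <= 4 / M%:R.
Proof.
move=> M0; wlog yx : x y / y <= x => [h hx hy|hx hy].
  by case: (leP y x) => [yx|/ltW xy]; [exact: h|rewrite distrC; exact: h].
pose dh (t : R) := - 2 * (odd_sin_sum M t + odd_sin_sum M (2 * t)).
have D (t : R) : is_derive t (1 : R) (fun u : R => 2 * odd_cos_sum M u + odd_cos_sum M (2 * u)) (dh t).
  have d1 := @is_deriveZ _ _ _ _ (2 : R) t 1 _ (is_derive_odd_cos_sum M t).
  have d2 : is_derive t (1 : R) (fun u : R => 2 * u) (2 * 1).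
    exact: (@is_deriveZ _ _ _ (id : R -> R) (2 : R) t 1 _ _).
  have d3 := @is_derive1_comp _ (odd_cos_sum M) (fun u => 2 * u) t _ _ (is_derive_odd_cos_sum M (2 * t)) d2.
  apply: (@is_derive_eq _ _ _ _ _ _ _ _ (@is_deriveD _ _ _ _ _ _ _ _ _ d1 d3)).
  by rewrite /dh /GRing.scale /=; ring.
have K (t : R) : 5 * pi / 8 <= t <= 3 * pi / 4 -> `|dh t| <= 4 / M%:R.
  move=> /andP[t1 t2]; have p0 := pi_gt0 R.
  rewrite /dh odd_sin_sum_reflect normrM normrN (ger0_norm (_ : 0 <= 2))//.
  have -> : 4 / M%:R = 2 * (2 / M%:R) :> R by ring.
  rewrite ler_pM2l//; apply: odd_sin_sum_near_const => //; apply/andP; split; lra.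
have h : `|(2 * odd_cos_sum M x + odd_cos_sum M (2 * x)) -
    (2 * odd_cos_sum M y + odd_cos_sum M (2 * y))| <= 4 / M%:R * (x - y).
  apply: (@norm_mean_value R _ dh (4 / M%:R) y x yx (fun t _ => D t)) => t /andP[t1 t2].
  by apply: K; move/andP: hx => [? ?]; move/andP: hy => [? ?]; apply/andP; split; lra.
apply: (le_trans h); rewrite -[leRHS]mulr1 ler_wpM2l ?divr_ge0//.
by have := pihalf_lt2 R; move/andP: hx => [? ?]; move/andP: hy => [? ?]; lra.
Qed.

(** Indices are taken four at a time: the odd ones give two new terms of the first sum, and [4M+2]
    gives one of the second because [2 / (4M+2)^2 = (1/2) / (2M+1)^2]; multiples of [4] have weight
    zero. *)
Lemma symsum_gamma_cos M (theta : R) :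
  symsum (fun k => w k * cos (2 * pi * k%:~R * theta)) (4 * M) =
  2 * odd_cos_sum M.*2 (2 * pi * theta) + odd_cos_sum M (2 * (2 * pi * theta)).
Proof.
set x := 2 * pi * theta.
have termE k : w (Posz k.+1) * cos (2 * pi * k.+1%:~R * theta) +
    w (Negz k) * cos (2 * pi * (Negz k)%:~R * theta)
   = 2 * (w k.+1 * cos (k.+1%:R * x)).
  rewrite NegzE gamma_weightN intrN mulrN mulNr cosN.
  by rewrite (_ : 2 * pi * k.+1%:~R * theta = k.+1%:R * x); [ring|rewrite /x; ring].
rewrite /symsum gamma_weight0 mul0r add0r.
under eq_bigr do rewrite termE.
elim: M => [|M IH]; first by rewrite muln0 double0 /odd_cos_sum !big_geq//; ring.
rewrite mulnS (_ : (4 + 4 * M)%N = (4 * M).+4); last by lia.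
do 4 rewrite big_nat_recr//=.
rewrite IH doubleS /odd_cos_sum; do 3 rewrite [in RHS]big_nat_recr//=.
rewrite !gamma_weight_nat.
have -> : (4 %| (4 * M).+1)%N = false by lia.
have -> : (4 %| (4 * M).+2)%N = false by lia.
have -> : (4 %| (4 * M).+3)%N = false by lia.
have -> : (4 %| (4 * M).+4)%N by lia.
have -> : (2 %| (4 * M).+1)%N = false by lia.
have -> : (2 %| (4 * M).+2)%N by lia.
have -> : (2 %| (4 * M).+3)%N = false by lia.
have -> : (M.*2.*2.+1) = (4 * M).+1 by lia.
have -> : (M.*2.+1).*2.+1 = (4 * M).+3 by lia.
have e : (4 * M).+2%:R = 2 * M.*2.+1%:R :> R.
  by rewrite -natrM; congr (_%:R); lia.
have -> : 2 / (4 * M).+2%:R ^+ 2 = 2^-1 * M.*2.+1%:R ^- 2 :> R.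
  have : M.*2.+1%:R != 0 :> R by rewrite pnatr_eq0.
  by rewrite e; move: (M.*2.+1%:R : R) => q q0; field.
have -> : (4 * M).+2%:R * x = M.*2.+1%:R * (2 * x) by rewrite e; ring.
rewrite [2 * (2^-1 / _ * _)]mulrA [2 * (2^-1 / _)]mulrA mulfV ?mul1r ?pnatr_eq0//; ring.
Qed.

(** The weight is even and the sine odd, so the imaginary part cancels in every symmetric partial
    sum. *)
Lemma gamma_floquetE (theta : R) :
  gamma_floquet theta = (zsum (fun k => w k * cos (2 * pi * k%:~R * theta)))%:C.
Proof.
rewrite /gamma_floquet /czsum; apply/eqP; rewrite eq_complex /=; apply/andP; split; apply/eqP.
  by congr zsum; apply/funext => k /=; rewrite mul0r subr0.
apply: (@eq_of_dist_le_inv _ _ _ 4) => N N0.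
have bnd (k : int) : k != 0 -> `|complex.Im ((w k)%:C * expi (2 * pi * k%:~R * theta))| <= 2 / k%:~R ^+ 2.
  move=> _ /=; rewrite mul0r addr0 normrM -[leRHS]mulr1; apply: ler_pM => //; first exact: gamma_weight_bound.
  exact: sin_max.
have := zsum_approx bnd N0.
rewrite (_ : symsum _ N = 0); first by rewrite (_ : 2 * 2 = 4 :> R) // -natrM.
rewrite /symsum /= !mul0r !addr0 big1 ?gamma_weight0 ?mul0r ?addr0// => k _.
by rewrite NegzE gamma_weightN intrN mulrN mulNr sinN mulrN addrC !mul0r !addr0 addNr.
Qed.

Lemma gamma_band_approx (theta : R) N : (0 < N)%N ->
  `|zsum (fun k => w k * cos (2 * pi * k%:~R * theta)) -
    symsum (fun k => w k * cos (2 * pi * k%:~R * theta)) N| <= 4 / N%:R.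
Proof.
move=> N0; have -> : (4 : R) = 2 * 2 by rewrite -natrM.
apply: zsum_approx => // k _.
rewrite normrM -[leRHS]mulr1; apply: ler_pM => //; first exact: gamma_weight_bound.
exact: cos_max.
Qed.

(** The [M] additional terms are each at most [1/M^2]. This reconciles the lengths [2M] and [M] of
    the two cosine sums. *)
Lemma odd_cos_sum_double M (x : R) : (0 < M)%N ->
  `|odd_cos_sum M.*2 x - odd_cos_sum M x| <= M%:R^-1.
Proof.
move=> M0; have m0 : (0 : R) < M%:R by rewrite ltr0n.
rewrite /odd_cos_sum (big_cat_nat (n := M) (m := 0%N) (p := M.*2))//=; last by lia.
rewrite addrAC subrr add0r; apply: (le_trans (ler_norm_sum _ _ _)).
apply: (@le_trans _ _ (\sum_(M <= i < M.*2) (M%:R ^+ 2)^-1)).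
  rewrite !big_nat; apply: ler_sum => i /andP[Mi _].
  rewrite normrM ger0_norm ?invr_ge0 ?sqr_ge0// -[leRHS]mulr1.
  apply: ler_pM; rewrite ?invr_ge0 ?sqr_ge0 ?cos_max//.
  rewrite lef_pV2 ?posrE ?exprn_gt0 ?ltr0n//.
  by rewrite lerXn2r ?nnegrE// ler_nat; lia.
rewrite sumr_const_nat (_ : (M.*2 - M)%N = M); last by lia.
rewrite -[leLHS]mulr_natr (_ : _ * _ = M%:R^-1)//.
by have := lt0r_neq0 m0; move: (M%:R : R) => q q0; field.
Qed.

Lemma gamma_band_flat (t u : R) : 5 / 16 <= t <= 3 / 8 -> 5 / 16 <= u <= 3 / 8 ->
  zsum (fun k => w k * cos (2 * pi * k%:~R * t)) = zsum (fun k => w k * cos (2 * pi * k%:~R * u)).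
Proof.
(* [10 = 4 + 2 + 4]: the variation of the partial sum, two truncation errors [4/(4M)], and two
   changes of length, each doubled by the factor [2]. *)
move=> ht hu; apply: (@eq_of_dist_le_inv _ _ _ 10) => M M0.
have M40 : (0 < 4 * M)%N by lia.
have m0 : (0 : R) < M%:R by rewrite ltr0n.
have := gamma_band_approx t M40; have := gamma_band_approx u M40.
rewrite !symsum_gamma_cos.
have -> : 4 / (4 * M)%:R = M%:R^-1 :> R.
  by rewrite natrM; field; rewrite lt0r_neq0.
have xin (v : R) : 5 / 16 <= v <= 3 / 8 -> 5 * pi / 8 <= 2 * pi * v <= 3 * pi / 4.
  by move=> /andP[h1 h2]; have p0 := pi_gt0 R; apply/andP; split; nra.
have := odd_cos_sum_double (2 * pi * t) M0; have := odd_cos_sum_double (2 * pi * u) M0.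
have := gamma_partial_sum_near_const M0 (xin t ht) (xin u hu).
have -> : 4 / M%:R = 4 * M%:R^-1 :> R by [].
have -> : 10 / M%:R = 10 * M%:R^-1 :> R by [].
rewrite !ler_norml; lra.
Qed.

(** All weights are nonnegative, so every pair [k], [- k] contributes a nonnegative amount to
    [E(0) - E(1/2)], and [k = 1] alone gives at least [2]. *)
Lemma gamma_band_nonconst :
  zsum (fun k => w k * cos (2 * pi * k%:~R * 0)) <> zsum (fun k => w k * cos (2 * pi * k%:~R * 2^-1)).
Proof.
move=> E.
pose D (N : nat) : R := symsum (fun k => w k * cos (2 * pi * k%:~R * 0)) N
   - symsum (fun k => w k * cos (2 * pi * k%:~R * 2^-1)) N.
have D2 N : (0 < N)%N -> 2 <= D N.
  case: N => // N _; rewrite /D /symsum gamma_weight0 !mul0r !add0r -sumrB big_nat_recl//=.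
  rewrite -[leLHS]addr0; apply: lerD.
    rewrite NegzE !gamma_weightN !gamma_weight_nat /= expr1n invr1 !mul1r !mulr0 !cos0.
    rewrite (_ : 2 * pi * 1%:~R * 2^-1 = pi); last by field.
    rewrite (_ : 2 * pi * (- (1 : int))%:~R * 2^-1 = - pi); last by rewrite intrN; field.
    by rewrite cosN cospi; lra.
  apply: sumr_ge0 => k _; rewrite opprD addrACA -!mulrBr addr_ge0// mulr_ge0 ?gamma_weight_ge0//.
    by rewrite mulr0 cos0 subr_ge0 cos_le1.
  by rewrite mulr0 cos0 subr_ge0 cos_le1.
(* At [N = 5] the two truncation errors add up to [8/5 < 2]. *)
have h1 := @gamma_band_approx 0 5 isT; have h2 := @gamma_band_approx 2^-1 5 isT.
have := D2 5%N isT; rewrite /D; move: h1 h2; rewrite E.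
rewrite !ler_norml => /andP[h1 h2] /andP[h3 h4]; lra.
Qed.

End GammaBand.

Lemma big_uniq_subset (V : nmodType) (I : eqType) (s L : seq I) (u : I -> V) :
  uniq s -> uniq L -> {subset s <= L} ->
  \sum_(i <- L) u i = \sum_(i <- s) u i + \sum_(i <- L | i \notin s) u i.
Proof.
move=> us uL sL; rewrite (bigID (mem s)) /=; congr (_ + _).
rewrite -big_filter; apply: perm_big; apply: uniq_perm => //; first exact: filter_uniq.
by move=> x; rewrite mem_filter; apply: andb_idr => /sL.
Qed.

(** * Finite sums over the integers *)

Section IntegerSums.
Variable R : realType.

Definition int_ball (N : nat) : seq int :=
  [seq Posz k | k <- iota 0 N.+1] ++ [seq Negz k | k <- iota 0 N].

Lemma mem_int_ball N k : (k \in int_ball N) = (`|k| <= N)%N.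
Proof.
rewrite mem_cat; apply/orP/idP.
  move=> [/mapP[j jN ->]|/mapP[j jN ->]]; rewrite mem_iota in jN; first by lia.
  by rewrite NegzE abszN; lia.
case: k => k kN; [left|right]; apply/mapP; exists k => //; rewrite mem_iota; first by lia.
by rewrite NegzE abszN in kN; lia.
Qed.

Lemma uniq_int_ball N : uniq (int_ball N).
Proof.
rewrite cat_uniq !map_inj_uniq ?iota_uniq// => [|x y [] //|x y [] //].
by rewrite andbT /=; apply/hasPn => _ /mapP[j _ ->]; apply/mapP => -[].
Qed.

Lemma symsumE (u : int -> R) N : symsum u N = \sum_(k <- int_ball N) u k.
Proof.
rewrite /symsum /int_ball big_cat !big_map /= big_cons big_split /= addrA.
rewrite /index_iota subn0; congr (_ + _ + _).
by rewrite (_ : iota 1 N = [seq k.+1 | k <- iota 0 N]) ?big_map//; exact: (iotaDl 1 0 N).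
Qed.

Lemma seq_in_int_ball (s : seq int) : exists2 N : nat, (0 < N)%N & {subset s <= int_ball N}.
Proof.
exists (\sum_(k <- s) `|k|)%N.+1 => // k ks; rewrite mem_int_ball.
by rewrite (big_rem k ks) /=; lia.
Qed.

Lemma int_ballS N M : (N <= M)%N -> {subset int_ball N <= int_ball M}.
Proof. by move=> NM k; rewrite !mem_int_ball => /leq_trans; apply. Qed.

Lemma zsum_finite (u : int -> R) (s : seq int) : uniq s ->
  (forall k, k \notin s -> u k = 0) -> zsum u = \sum_(k <- s) u k.
Proof.
move=> us hu; have [N0 N00 sN0] := seq_in_int_ball s.
(* With this constant, a finitely supported [u] satisfies the decay hypothesis of [zsum_approx]. *)
pose C := \sum_(k <- s) `|u k| * k%:~R ^+ 2.
have bnd k : k != 0 -> `|u k| <= C / k%:~R ^+ 2.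
  move=> k0; have k2 : 0 < k%:~R ^+ 2 :> R by rewrite lt_def sqr_ge0 sqrf_eq0 intr_eq0 k0.
  rewrite ler_pdivlMr//; have [ks|/hu ->] := boolP (k \in s).
    rewrite /C (big_rem k ks) /= lerDl; apply: sumr_ge0 => j _.
    by rewrite mulr_ge0 ?sqr_ge0.
  by rewrite normr0 mul0r; apply: sumr_ge0 => j _; rewrite mulr_ge0 ?sqr_ge0.
apply: (@eq_of_dist_le_inv _ _ _ (2 * C)) => N N1.
(* The radius is at least [N0], so the ball contains [s], and at least [N], so the error is
   O(1/N). *)
have M0 : (0 < N * N0)%N by rewrite muln_gt0 N1.
have := zsum_approx bnd M0.
have -> : symsum u (N * N0) = \sum_(k <- s) u k.
  rewrite symsumE (@big_uniq_subset _ _ s _ u us (uniq_int_ball _)); last first.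
    by move=> k /sN0; apply: int_ballS; rewrite leq_pmull.
  by rewrite [X in _ + X]big1 ?addr0// => k; exact: hu.
move=> h; apply: (le_trans h); rewrite ler_wpM2l//.
  by rewrite mulr_ge0//; apply: sumr_ge0 => j _; rewrite mulr_ge0 ?sqr_ge0.
by rewrite lef_pV2 ?posrE ?ltr0n// ler_nat leq_pmulr.
Qed.

Lemma sum_uniq_bounded (u : int -> R) (C : R) : (forall k, 0 <= u k) ->
  (forall k, k != 0 -> u k <= C / k%:~R ^+ 2) ->
  exists S : R, forall s : seq int, uniq s -> \sum_(k <- s) u k <= S.
Proof.
move=> u0 hu; exists (zsum u + 2 * C) => s us.
have [N N0 sN] := seq_in_int_ball s.
have bnd k : k != 0 -> `|u k| <= C / k%:~R ^+ 2 by move=> k0; rewrite ger0_norm ?hu.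
have C0 : 0 <= C by have := le_trans (u0 1) (hu 1 isT); rewrite expr1n divr1.
apply: (@le_trans _ _ (symsum u N)).
  rewrite symsumE (@big_uniq_subset _ _ s _ u us (uniq_int_ball _) sN) lerDl.
  by apply: sumr_ge0 => k _.
have := zsum_approx bnd N0.
have : 2 * C / N%:R <= 2 * C by rewrite ler_pdivrMr ?ltr0n// ler_peMr ?mulr_ge0// ler1n.
by rewrite ler_norml; move: (_ / _) => x; lra.
Qed.

End IntegerSums.

(** * Eigenfunctions and finite support *)

Section GammaEigenfunctions.
Variable R : realType.
Local Notation w := (@gamma_weight R).

(** A primitive in [t] of [cos (2 pi n t + p)], with the resonant case [n = 0] apart. The phases [0]
    and [- pi/2] produce the real and imaginary parts of Fourier coefficients. *)
Definition cos_primitive (p : R) (n : int) (t : R) : R :=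
  if n == 0 then t * cos p else sin (2 * pi * n%:~R * t + p) / (2 * pi * n%:~R).

Lemma is_derive_cos_primitive p n (t : R) :
  is_derive t (1 : R) (cos_primitive p n) (cos (2 * pi * n%:~R * t + p)).
Proof.
rewrite /cos_primitive; have [->|n0] := eqVneq n 0.
  rewrite mulr0 mul0r add0r.
  have D := @is_deriveZ _ _ _ (id : R -> R) (cos p) t 1 _ _.
  rewrite (_ : (fun t0 => _) = cos p *: (id : R -> R)); last first.
    by apply/funext => u; rewrite /GRing.scale /= mulrC.
  by apply: is_derive_eq; rewrite /GRing.scale /= mulr1.
have k0 : 2 * pi * n%:~R != 0 :> R by rewrite !mulf_neq0 ?intr_eq0// gt_eqF// pi_gt0.
have D := is_derive_sinM (2 * pi * n%:~R)^-1 (2 * pi * n%:~R) p t.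
rewrite (_ : (fun t0 => _) = (fun t : R => (2 * pi * n%:~R)^-1 * sin (2 * pi * n%:~R * t + p))).
  by apply: (@is_derive_eq _ _ _ _ _ _ _ _ D); rewrite mulVf ?mul1r.
by apply/funext => u; rewrite mulrC.
Qed.

(* Fourier coefficients of the indicator function of [ [a, b] ]. *)
Definition interval_fourier (a b : R) (n : int) : R[i] :=
  (cos_primitive 0 n b - cos_primitive 0 n a) +i*
  (cos_primitive (- (pi / 2)) n b - cos_primitive (- (pi / 2)) n a).

Lemma interval_fourierE a b (n : int) : n != 0 ->
  (2 * pi * n%:~R)%:C * interval_fourier a b n =
  - 'i%C * (expi (2 * pi * n%:~R * b) - expi (2 * pi * n%:~R * a)).
Proof.
move=> n0; rewrite /interval_fourier /cos_primitive (negbTE n0) /expi.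
have k0 : 2 * pi * n%:~R != 0 :> R by rewrite !mulf_neq0 ?intr_eq0// gt_eqF// pi_gt0.
apply/eqP; rewrite eq_complex /= !addr0 !sinBpihalf.
by move: (2 * pi * n%:~R) k0 => q k0; apply/andP; split; apply/eqP; field.
Qed.

Lemma norm_cos_primitive (p : R) n t : n != 0 -> `|cos_primitive p n t| <= `|n|%:~R^-1.
Proof.
move=> n0; rewrite /cos_primitive (negbTE n0) normrM.
rewrite -[leRHS]mul1r; apply: ler_pM => //; first exact: sin_max.
have n0' : (0 : R) < `|n|%:~R by rewrite ltr0z normr_gt0.
rewrite normfV lef_pV2 ?posrE ?normr_gt0; last 2 first.
- by rewrite !mulf_neq0 ?intr_eq0// gt_eqF// pi_gt0.
- by [].
rewrite !normrM -intr_norm (ger0_norm (_ : 0 <= 2))// ger0_norm ?pi_ge0//.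
by rewrite ler_peMl ?(ltW n0')//; have := pi_ge2 R; lra.
Qed.

Lemma l2_interval_fourier a b : l2 (interval_fourier a b).
Proof.
apply/l2P; apply: (@sum_uniq_bounded _ _ 8) => [k|k k0]; first exact: sqnorm_ge0.
rewrite /sqnorm /=.
have i0 : 0 <= (`|k|%:~R^-1 : R) by rewrite invr_ge0 ler0z.
have -> : 8 / k%:~R ^+ 2 = (2 * `|k|%:~R^-1) ^+ 2 + (2 * `|k|%:~R^-1) ^+ 2 :> R.
  by rewrite exprMn exprVn intr_norm real_normK ?num_real//; ring.
have sq (p : R) : (cos_primitive p k b - cos_primitive p k a) ^+ 2 <= (2 * `|k|%:~R^-1) ^+ 2.
  rewrite -[leLHS]real_normK ?num_real// lerXn2r ?nnegrE ?mulr_ge0//.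
  apply: (le_trans (ler_normB _ _)).
  by have := norm_cos_primitive p b k0; have := norm_cos_primitive p a k0; lra.
exact: lerD.
Qed.

(* As a function of [b], the [N]-th partial sum of the left-hand side has
   derivative [cos (2 pi n b + p) E_N(b)], the sine terms cancelling by parity, and
   [E_N - E] is O(1/N) where the band is flat. *)
Lemma gamma_conv_cos_primitive (p a b E : R) (n : int) :
  5 / 16 <= a -> a <= b -> b <= 3 / 8 ->
  (forall t, 5 / 16 <= t <= 3 / 8 -> zsum (fun k => w k * cos (2 * pi * k%:~R * t)) = E) ->
  zsum (fun k => w k * (cos_primitive p (n + k) b - cos_primitive p (n + k) a)) =
  E * (cos_primitive p n b - cos_primitive p n a).
Proof.
move=> a1 ab b1 flat.
pose H (k : int) (t : R) := cos_primitive p (n + k) t.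
pose F (N : nat) (t : R) := symsum (fun k => w k * H k t) N - E * cos_primitive p n t.
pose dF (N : nat) (t : R) := symsum (fun k => w k * cos (2 * pi * (n + k)%:~R * t + p)) N
   - E * cos (2 * pi * n%:~R * t + p).
have DF N (t : R) : is_derive t (1 : R) (F N) (dF N t).
  have dH k : is_derive t (1 : R) (fun u : R => w k * H k u) (w k * cos (2 * pi * (n + k)%:~R * t + p)).
    exact: (@is_deriveZ _ _ _ _ (w k) t 1 _ (is_derive_cos_primitive p (n + k) t)).
  have dE : is_derive t (1 : R) (fun u : R => E * cos_primitive p n u) (E * cos (2 * pi * n%:~R * t + p)).
    exact: (@is_deriveZ _ _ _ _ E t 1 _ (is_derive_cos_primitive p n t)).
  have dS : is_derive t (1 : R) (fun u : R => symsum (fun k => w k * H k u) N)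
      (symsum (fun k => w k * cos (2 * pi * (n + k)%:~R * t + p)) N).
    apply: (@is_deriveD _ _ _ (fun u => w 0 * H 0 u)
      (fun u => \sum_(0 <= k < N) (w k.+1 * H k.+1 u + w (Negz k) * H (Negz k) u))).
    apply: (is_derive_bigsum N (dh := fun k t => w k.+1 * cos (2 * pi * (n + k.+1)%:~R * t + p) +
      w (Negz k) * cos (2 * pi * (n + Negz k)%:~R * t + p))).
  exact: (@is_deriveB _ _ _ _ _ _ _ _ _ dS dE).
have dFE N t : dF N t = cos (2 * pi * n%:~R * t + p) *
    (symsum (fun k => w k * cos (2 * pi * k%:~R * t)) N - E).
  rewrite /dF mulrBr (mulrC E); congr (_ - _).
  rewrite /symsum [RHS]mulrDr [X in _ = _ + X]mulr_sumr; congr (_ + _).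
    by rewrite gamma_weight0 !mul0r mulr0.
  apply: eq_bigr => k _; rewrite NegzE gamma_weightN !intrD !intrN.
  set x := 2 * pi * n%:~R * t + p; set y := 2 * pi * k.+1%:~R * t.
  rewrite (_ : 2 * pi * (n%:~R + k.+1%:~R) * t + p = x + y); last by rewrite /x /y; ring.
  rewrite (_ : 2 * pi * (n%:~R - k.+1%:~R) * t + p = x - y); last by rewrite /x /y; ring.
  rewrite (_ : 2 * pi * - k.+1%:~R * t = - y); last by rewrite /y; ring.
  by rewrite cosN cosD cosB; ring.
have Fab N : (0 < N)%N -> `|F N b - F N a| <= 4 / N%:R.
  move=> N0; apply: (@le_trans _ _ (4 / N%:R * (b - a))).
    apply: (norm_mean_value ab (fun t _ => DF N t)) => t /andP[t1 t2].
    have tI : 5 / 16 <= t <= 3 / 8 by apply/andP; split; lra.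
    rewrite dFE normrM -[leRHS]mul1r; apply: ler_pM => //; first exact: cos_max.
    by rewrite distrC -(flat t tI); exact: gamma_band_approx.
  by rewrite -[leRHS]mulr1 ler_wpM2l ?divr_ge0//; lra.
have bnd (k : int) : k != 0 ->
    `|w k * (cos_primitive p (n + k) b - cos_primitive p (n + k) a)| <= 4 / k%:~R ^+ 2.
  move=> k0; rewrite normrM (_ : 4 = 2 * 2); last by rewrite -natrM.
  rewrite mulrAC; apply: ler_pM => //; first exact: gamma_weight_bound.
  have [e0|nk] := eqVneq (n + k) 0.
    rewrite e0 /cos_primitive eqxx -mulrBl normrM -[leRHS]mulr1; apply: ler_pM => //; last exact: cos_max.
    by rewrite ger0_norm; lra.
  have i1 : `|n + k|%:~R^-1 <= 1 :> R.
    by rewrite invf_le1 ?ltr0z ?normr_gt0// ler1z; lia.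
  have h1 := norm_cos_primitive p b nk; have h2 := norm_cos_primitive p a nk.
  by apply: (le_trans (ler_normB _ _)); lra.
(* [8/N] comes from truncating the series, whose terms are at most [4/k^2], and [4/N] from [Fab]. *)
apply: (@eq_of_dist_le_inv _ _ _ 12) => N N0.
have := zsum_approx bnd N0; have := Fab N N0.
have -> : F N b - F N a = symsum (fun k => w k * (cos_primitive p (n + k) b - cos_primitive p (n + k) a)) N
   - E * (cos_primitive p n b - cos_primitive p n a).
  rewrite /F /symsum /H.
  under [X in _ = _ + X - _]eq_bigr do rewrite 2!mulrBr addrACA -opprD.
  by rewrite sumrB; ring.
have -> : 2 * 4 / N%:R = 8 * N%:R^-1 :> R by ring.
have -> : 4 / N%:R = 4 * N%:R^-1 :> R by [].
have -> : 12 / N%:R = 12 * N%:R^-1 :> R by [].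
by rewrite !ler_norml; lra.
Qed.

Lemma gamma_eigenfunction (a b E : R) :
  5 / 16 <= a -> a <= b -> b <= 3 / 8 ->
  (forall t, 5 / 16 <= t <= 3 / 8 -> zsum (fun k => w k * cos (2 * pi * k%:~R * t)) = E) ->
  eigenspace_l2 (@gamma_adjacency R) E%:C (interval_fourier a b).
Proof.
move=> a1 ab b1 flat; split; first exact: l2_interval_fourier.
move=> n; rewrite /gamma_adjacency /czsum; apply/eqP; rewrite eq_complex /=.
rewrite !mul0r !subr0 !addr0 -!(@gamma_conv_cos_primitive _ a b E)//.
by apply/andP; split; apply/eqP; congr zsum; apply/funext => k; rewrite /= mul0r ?subr0 ?addr0.
Qed.

(* Testing a vanishing combination of powers against a Lagrange polynomial. *)
Lemma powers_free (F : fieldType) (s : seq F) (c : F -> F) : uniq s ->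
  (forall m : nat, \sum_(z <- s) c z * z ^+ m = 0) -> forall z, z \in s -> c z = 0.
Proof.
move=> us hs z zs.
pose q := \prod_(y <- rem z s) ('X - y%:P).
have : \sum_(y <- s) c y * q.[y] = 0.
  transitivity (\sum_(i < size q) q`_i * \sum_(y <- s) c y * y ^+ i); last first.
    by apply: big1 => i _; rewrite hs mulr0.
  under [RHS]eq_bigr do rewrite mulr_sumr.
  rewrite exchange_big /=; apply: eq_bigr => y _.
  by rewrite horner_coef mulr_sumr; apply: eq_bigr => i _; rewrite mulrCA.
rewrite (bigD1_seq z)//= big1_seq ?addr0 => [/eqP|y /andP[yz ys]]; last first.
  have : root q y by rewrite root_prod_XsubC mem_rem_uniq// inE yz.
  by rewrite /root => /eqP ->; rewrite mulr0.
rewrite mulf_eq0 => /orP[/eqP //|]; rewrite -[_ == 0]/(root q z) root_prod_XsubC mem_rem_uniq//.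
by rewrite inE eqxx.
Qed.

(** Intervals with common left end [b 0] and distinct right ends are used: up to a nonzero factor,
    the coefficient at [m > 0] is [z i.+1 ^ m - z 0 ^ m], so a linear relation becomes a vanishing
    combination of powers of distinct numbers. *)
Lemma gamma_infinitely_degenerate : exists E : R, infinitely_degenerate (@gamma_adjacency R) E%:C.
Proof.
pose E := zsum (fun k => w k * cos (2 * pi * k%:~R * (3 / 8))).
have flat t : 5 / 16 <= t <= 3 / 8 -> zsum (fun k => w k * cos (2 * pi * k%:~R * t)) = E.
  by move=> ht; apply: gamma_band_flat => //; lra.
exists E => n.
have n0 : (0 : R) < n.+1%:R by rewrite ltr0n.
pose b (i : nat) : R := 5 / 16 + i%:R / n.+1%:R / 16.
have bI i : (i <= n)%N -> 5 / 16 <= b i <= 3 / 8.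
  move=> hi; have h1 : (0 : R) <= i%:R / n.+1%:R by rewrite divr_ge0.
  have h2 : i%:R / n.+1%:R <= 1 :> R by rewrite ler_pdivrMr// mul1r ler_nat; lia.
  by rewrite /b; move: (i%:R / n.+1%:R : R) h1 h2 => v h1 h2; apply/andP; split; lra.
exists (fun i : 'I_n => interval_fourier (5 / 16) (b i.+1)); split.
  move=> i; have /andP[h1 h2] := bI i.+1 (ltn_ord i).
  by apply: gamma_eigenfunction.
move=> c hc.
pose z (i : nat) : R[i] := expi (2 * pi * b i).
have zinj i j : (i <= n)%N -> (j <= n)%N -> z i = z j -> i = j.
  move=> hi hj zij; apply/eqP; apply/negP => /negP ij.
  have : expi (2 * pi * (b i - b j)) != 1.
    apply: expi_neq1; have /andP[h1 h2] := bI i hi; have /andP[h3 h4] := bI j hj.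
    rewrite normr_gt0 ltr_norml; apply/andP; split; last by apply/andP; split; lra.
    rewrite /b subr_eq0 (inj_eq (addrI _)).
    rewrite (inj_eq (mulIf _)) ?invr_eq0// (inj_eq (mulIf _)) ?eqr_nat//.
  by rewrite mulrBr expiD expiN -/(z i) -/(z j) zij mulfV ?eqxx// expi_neq0.
pose s := [seq z i | i <- iota 0 n.+1].
have us : uniq s.
  rewrite map_inj_in_uniq ?iota_uniq// => i j; rewrite !mem_iota !add0n !ltnS => hi hj.
  exact: zinj.
(* The common left end collects [- \sum_i c i], and each right end its own coefficient. *)
pose C (x : R[i]) : R[i] := if x == z 0%N then - \sum_i c i else
   \sum_(i < n) c i *+ (x == z i.+1).
have C0 : C (z 0%N) = - \sum_i c i by rewrite /C eqxx.
have CS (i : 'I_n) : C (z i.+1) = c i.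
  rewrite /C ifN; last by apply/eqP => /(zinj _ _ (ltn_ord i) (leq0n n)).
  rewrite (bigD1 i)//= eqxx big1 ?addr0// => j ji.
  have [/(zinj _ _ (ltn_ord i) (ltn_ord j)) [] /val_inj ij|//] := eqVneq (z i.+1) (z j.+1).
  by rewrite ij eqxx in ji.
have key (m : nat) : \sum_(x <- s) C x * x ^+ m = 0.
  transitivity (\sum_(0 <= i < n.+1) C (z i) * z i ^+ m).
    by rewrite /s big_map /index_iota subn0.
  rewrite big_nat_recl//= C0.
  rewrite big_mkord [X in _ + X](eq_bigr (fun i : 'I_n => c i * z i.+1 ^+ m)) => [|i _]; last by rewrite CS.
  rewrite mulNr mulr_suml -sumrN addrC -big_split /=.
  (* Exponent [0] is settled by the choice of the coefficient at [z 0]; the others come from the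
     relation at the vertex [m.+1]. *)
  case: m => [|m]; first by apply: big1 => i _; rewrite !expr0 subrr.
  have := hc (Posz m.+1) => /(congr1 (fun x => 'i%C * ((2 * pi * m.+1%:~R)%:C * x))).
  rewrite !mulr0 !mulr_sumr => h; rewrite -[RHS]h; apply: eq_bigr => i _.
  have -> : 'i%C * ((2 * pi * m.+1%:~R)%:C * (c i * interval_fourier (5 / 16) (b i.+1) m.+1))
    = c i * ('i%C * ((2 * pi * m.+1%:~R)%:C * interval_fourier (5 / 16) (b i.+1) m.+1)) by ring.
  have iK x : 'i%C * (- 'i%C * x) = x :> R[i] by rewrite mulrA mulrN -expr2 sqr_i opprK mul1r.
  rewrite interval_fourierE// iK mulrBr.
  have zX j : expi (2 * pi * m.+1%:~R * b j) = z j ^+ m.+1.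
    by rewrite /z -expiX; congr expi; ring.
  rewrite zX (_ : 5 / 16 = b 0%N) ?zX//.
  by rewrite /b mul0r mul0r addr0.
move=> i; rewrite -CS; apply: (powers_free us key).
by apply/mapP; exists i.+1 => //; rewrite mem_iota /= ltnS.
Qed.

(* On the residue class of [m0 - 1] modulo 4, far from the support, the
   eigenvalue equation is a vanishing rational function with only double poles. *)
Lemma gamma_no_finite_support (lambda : R[i]) :
  ~ exists psi, finite_support_eigenvector (@gamma_adjacency R) lambda psi.
Proof.
move=> [psi [[[_ sol] [m0 nz]] fin]].
have /finite_seqP[s0 hs0] := fin.
pose s := undup s0.
have us : uniq s by exact: undup_uniq.
have sP m : m \notin s -> psi m = 0.
  rewrite mem_undup => ms; apply/eqP; apply/negP => /negP h; move/negP: ms; apply.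
  by have : [set x | psi x != 0] m by []; rewrite hs0.
have m0s : m0 \in s by apply/negP => /negP /sP h; rewrite h eqxx in nz.
have conv n : n \notin s -> \sum_(m <- s) (w (m - n))%:C * psi m = 0.
  move=> ns; have := sol n; rewrite (sP n ns) mulr0 /gamma_adjacency /czsum.
  have part (f : R[i] -> R) (f0 : f 0 = 0) : zsum (fun k => w k * f (psi (n + k))) =
      \sum_(m <- s) w (m - n) * f (psi m).
    rewrite (@zsum_finite _ _ [seq m - n | m <- s]); first last.
    - move=> k; have [ks|/sP ->] := boolP (n + k \in s); last by rewrite f0 mulr0.
      by move=> /mapP; case; exists (n + k) => //; rewrite addrC addKr.
    - by rewrite map_inj_uniq// => x y /addIr.
    - by rewrite big_map; apply: eq_bigr => m _; rewrite [n + _]addrC subrK.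
  move=> /eqP; rewrite eq_complex /= => /andP[/eqP re /eqP im].
  apply/eqP; rewrite eq_complex /= !raddf_sum /=; apply/andP; split; apply/eqP.
    rewrite -[RHS]re.
    rewrite [RHS](_ : _ = zsum (fun k => w k * complex.Re (psi (n + k)))); last first.
      by congr zsum; apply/funext => k /=; case: (psi _) => x y /=; rewrite mul0r subr0.
    rewrite (part (@complex.Re R))//; apply: eq_bigr => m _.
    by case: (psi m) => x y /=; rewrite mul0r subr0.
  rewrite -[RHS]im.
  rewrite [RHS](_ : _ = zsum (fun k => w k * complex.Im (psi (n + k)))); last first.
    by congr zsum; apply/funext => k /=; case: (psi _) => x y /=; rewrite mul0r addr0.
  rewrite (part (@complex.Im R))//; apply: eq_bigr => m _.
  by case: (psi m) => x y /=; rewrite mul0r addr0.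
(* For [n = m0 - 1 - 4M] one has [m - n = j m + 4M], so the class of [m - n] modulo 4, and with it
   the numerator [c], does not depend on [M]. *)
pose j (m : int) : int := m - m0 + 1.
pose c (k : int) : R[i] := if (4 %| k)%Z then 0 else if (2 %| k)%Z then 2 else 1.
have wE (k : int) : (w k)%:C = c k / (k%:~R) ^+ 2.
  rewrite /gamma_weight /c; case: ifP => _; first by rewrite mul0r.
  by case: ifP => _; rewrite ?rmorphM ?fmorphV rmorphXn /= rmorph_int ?rmorph_nat ?mul1r.
have c4 (k : int) (M : nat) : c (k + (4 * M)%:Z) = c k.
  rewrite /c !dvdzE; have -> : (absz (4%:Z) %| absz (k + (4 * M)%:Z)%R)%N = (absz (4%:Z) %| absz k)%N by lia.
  by have -> : (absz (2%:Z) %| absz (k + (4 * M)%:Z)%R)%N = (absz (2%:Z) %| absz k)%N by lia.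
pose fac (m : int) : {poly R[i]} := ('X + (j m)%:~R%:P) ^+ 2.
(* The eigenvalue equation with denominators cleared, as a polynomial in [4M]. *)
pose Q : {poly R[i]} := \sum_(m <- s) (c (j m) * psi m)%:P * \prod_(m' <- rem m s) fac m'.
pose M0 := (\sum_(m <- s) `|j m|)%N.
have jM0 m : m \in s -> (`|j m| <= M0)%N by move=> ms; rewrite /M0 (big_rem m ms) leq_addr.
have Qroot (M : nat) : (M0 < M)%N -> Q.[(4 * M)%:R] = 0.
  move=> MM; set n := m0 - 1 - (4 * M)%:Z.
  have jn m : m - n = j m + (4 * M)%:Z by rewrite /j /n; lia.
  have jne m : m \in s -> j m + (4 * M)%:Z != 0 by move=> /jM0; lia.
  have ns : n \notin s by apply/negP => /jne; rewrite -jn subrr eqxx.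
  have facE m : (fac m).[(4 * M)%:R] = (j m + (4 * M)%:Z)%:~R ^+ 2.
    by rewrite /fac !hornerE intrD addrC.
  rewrite /Q horner_sum.
  transitivity ((\prod_(m <- s) (fac m).[(4 * M)%:R]) * \sum_(m <- s) (w (m - n))%:C * psi m); last first.
    by rewrite conv// mulr0.
  rewrite mulr_sumr !big_seq; apply: eq_bigr => m ms.
  rewrite jn wE c4 hornerM hornerC horner_prod -big_seq [in RHS](big_rem m ms) /= facE.
  have : (j m + (4 * M)%:Z)%:~R != 0 :> R[i] by rewrite intr_eq0 jne.
  by move: (_%:~R) => x x0; field.
have Q0 : Q = 0.
  apply/eqP/negP => /negP Qn0.
  pose rs := [seq (4 * (M0.+1 + i))%:R : R[i] | i <- iota 0 (size Q)].
  have : all (root Q) rs by apply/allP => _ /mapP[i _ ->]; apply/eqP/Qroot; lia.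
  have urs : uniq rs.
    by rewrite map_inj_uniq ?iota_uniq// => x y /eqP; rewrite eqr_nat; lia.
  by move=> h; have := max_poly_roots Qn0 h urs; rewrite size_map size_iota ltnn.
(* As [j m0 = 1], every term except that of [m0] contains a factor vanishing at [-1]; the remaining
   one has [c 1 = 1] and factors [(m - m0)^2]. *)
have := congr1 (fun p => p.[-1]) Q0; rewrite /Q horner_sum horner0.
rewrite (bigD1_seq m0)//= [X in _ + X]big1_seq ?addr0 => [/eqP|m /andP[mm0 ms]]; last first.
  rewrite hornerM horner_prod (big_rem m0) /=; last by rewrite mem_rem_uniq// inE eq_sym mm0.
  have -> : (fac m0).[-1] = 0.
    by rewrite /fac /j subrr add0r horner_exp hornerD hornerX hornerC addNr expr0n.
  by rewrite mul0r mulr0.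
rewrite hornerM hornerC !mulf_eq0 (negbTE nz) orbF /j subrr add0r /c /= oner_eq0 /=.
rewrite horner_prod prodf_seq_eq0 => /hasP[m]; rewrite mem_rem_uniq// inE => /andP[mm0 _].
rewrite /= /fac horner_exp hornerD hornerX hornerC /j intrD addrC addrK sqrf_eq0 intr_eq0 subr_eq0.
by rewrite (negbTE mm0).
Qed.

End GammaEigenfunctions.

(** * Zero sets of trigonometric polynomials *)

Section GridCounting.
Variable R : realType.
Local Notation C := R[i].
Local Notation e t := (expi (2 * pi * t) : C).

Lemma sin_ge_on_arc (a b : R) : 0 < b -> b <= 2^-1 -> b <= a -> a <= 1 - b ->
  sin (pi * b) <= sin (pi * a).
Proof.
move=> b0 b2 ba ab; have p0 := pi_gt0 R.
wlog a2 : a ba ab / a <= 2^-1 => [h|].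
  have [/h|a2] := leP a 2^-1; first by apply.
  have -> : sin (pi * a) = sin (pi * (1 - a)).
    by rewrite mulrBr mulr1 sinB sinpi cospi; ring.
  by apply: h; lra.
move: ba; rewrite le_eqVlt => /predU1P[->//|ba].
by apply: ltW; rewrite ltr_sin ?in_itv /= ?ltr_pM2l//; apply/andP; split; nra.
Qed.

(** Grid points close to the same [z] are close to each other, hence have cyclically close indices;
    the radius does not depend on [z]. *)
Lemma arc_count (eta : R) : 0 < eta -> exists r : R, 0 < r /\ exists N0 : nat,
  forall N : nat, (N0 <= N)%N -> forall z : C,
  (count (fun j : nat => nc (e (j%:R / N%:R) - z) <= r) (iota 0 N))%:R <= eta * N%:R.
Proof.
move=> eta0.
(* [m > 4 / eta], and [m >= 2] keeps [1/m] where [sin (pi t)] increases; [c] is the chord of [1/m]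
   of a turn. *)
pose m := (Num.truncn (4 / eta)).+2.
have m2 : (1 < m)%N by [].
have m0 : (0 : R) < m%:R by rewrite ltr0n.
have meta : 4 / eta < m%:R.
  by apply: (lt_trans (truncnS_gt _)); rewrite ltr_nat.
have im2 : m%:R^-1 <= 2^-1 :> R by rewrite lef_pV2 ?posrE// ler_nat.
have im0 : 0 < m%:R^-1 :> R by rewrite invr_gt0.
pose c : R := 2 * sin (pi / m%:R).
have c0 : 0 < c.
  rewrite mulr_gt0// sin_gt0_pi// mulr_gt0 ?pi_gt0//=.
  by rewrite -[ltRHS]mulr1 ltr_pM2l ?pi_gt0//; lra.
exists (c / 3); split; first by rewrite divr_gt0.
exists m => N mN z.
have N0 : (0 < N)%N by apply: leq_trans mN.
have n0 : (0 : R) < N%:R by rewrite ltr0n.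
pose bad (j : nat) := nc (e (j%:R / N%:R) - z) <= c / 3.
rewrite -/(count bad _) -size_filter.
have close i j : bad i -> bad j -> (i <= j)%N -> (j < N)%N ->
    (j - i <= N %/ m)%N || (N - j <= N %/ m)%N.
  move=> bi bj ij jN; apply/negP => /negP; rewrite negb_or -!ltnNge => /andP[h1 h2].
  have : nc (e (j%:R / N%:R) - e (i%:R / N%:R)) <= 2 * (c / 3).
    rewrite (_ : _ - _ = (e (j%:R / N%:R) - z) - (e (i%:R / N%:R) - z)); last by rewrite opprB addrA subrK.
    by apply: (le_trans (ncD _ _)); rewrite ncN; move: bi bj; rewrite /bad; lra.
  apply/negP; rewrite -ltNge; apply: (@lt_le_trans _ _ c); first by lra.
  rewrite nc_expi_sub (_ : (2 * pi * (j%:R / N%:R) - 2 * pi * (i%:R / N%:R)) / 2 = pi * ((j - i)%:R / N%:R)); last first.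
    by rewrite natrB//; field; rewrite lt0r_neq0.
  apply: le_trans (ler_norm _); rewrite /c ler_pM2l//.
  have ji (k : nat) : (N < k * m)%N -> m%:R^-1 <= k%:R / N%:R :> R.
    move=> kl; rewrite ler_pdivlMr// mulrC ler_pdivrMr// -natrM ler_nat.
    exact: ltnW.
  apply: sin_ge_on_arc => //.
    by apply: ji; rewrite -ltn_divLR.
  have jiN : (j - i <= N)%N by rewrite (leq_trans (leq_subr i j) (ltnW jN)).
  have /ji : (N < (N - (j - i)) * m)%N.
    by rewrite -ltn_divLR//; apply: leq_trans h2 _; apply: leq_sub2l; exact: leq_subr.
  by rewrite natrB// mulrBl mulfV ?lt0r_neq0//; lra.
(* Bad indices lie within [N / m] of the least one or within [N / m] of [N], the latter by wrapping
   around the circle. *)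
have bound : (size [seq j <- iota 0 N | bad j] <= 2 * (N %/ m).+1)%N.
  case E : [seq j <- iota 0 N | bad j] => [|j0 l]; first by [].
  rewrite -E.
  have j0in : j0 \in [seq j <- iota 0 N | bad j] by rewrite E mem_head.
  have j0min j : j \in [seq j <- iota 0 N | bad j] -> (j0 <= j)%N.
    have : sorted ltn [seq j <- iota 0 N | bad j].
      by apply: sorted_filter; [exact: ltn_trans|exact: iota_ltn_sorted].
    rewrite E /= => /(order_path_min ltn_trans)/allP h.
    by rewrite inE => /predU1P[->//|/h /ltnW].
  apply: (@leq_trans (size (iota j0 (N %/ m).+1 ++ iota (N - (N %/ m).+1) (N %/ m).+1))).
    apply: uniq_leq_size; first by rewrite filter_uniq ?iota_uniq.
    move=> j jin; have jj := j0min j jin.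
    move: jin j0in; rewrite !mem_filter !mem_iota !add0n => /andP[bj /andP[_ jN]] /andP[bj0 /andP[_ _]].
    rewrite mem_cat !mem_iota; have := close j0 j bj0 bj jj jN.
    by have := leq_div N m; move: (N %/ m)%N => k; move: jN jj; clear; lia.
  by rewrite size_cat !size_iota; lia.
have h : (2 * (N %/ m).+1 * m <= 4 * N)%N.
  by have := leq_trunc_div N m; nia.
rewrite -(ler_pM2r m0); apply: (@le_trans _ _ (4 * N)%:R).
  by rewrite -natrM ler_nat; apply: leq_trans h; rewrite leq_mul2r bound orbT.
rewrite natrM mulrAC ler_pM2r// mulrC -ler_pdivrMr//; exact: ltW.
Qed.

Lemma count_has (T U : Type) (P : T -> U -> bool) (r : seq U) (s : seq T) :
  (count (fun x => has (P x) r) s <= \sum_(y <- r) count (P^~ y) s)%N.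
Proof.
elim: r => [|y r IH]; first by rewrite big_nil (eq_count (a2 := pred0)) ?count_pred0.
rewrite big_cons; apply: (@leq_trans (count (predU (P^~ y) (fun x => has (P x) r)) s)).
  by rewrite (eq_count (a2 := predU (P^~ y) (fun x => has (P x) r))).
by rewrite count_predUI leq_subLR in IH * || (have := count_predUI (P^~ y) (fun x => has (P x) r) s; lia).
Qed.

(** A point farther than [r] from all [J] roots has [|q| >= delta r^J], so small values occur only
    near a root, and the arcs around the roots are counted. Dividing by [J.+1] covers [J = 0]; the
    halved [eps] makes the comparison strict. *)
Lemma small_values_count (J : nat) (delta eta : R) : 0 < delta -> 0 < eta ->
  exists eps : R, 0 < eps /\ exists N0 : nat, forall N : nat, (N0 <= N)%N ->
  forall q : {poly C}, size q = J.+1 -> delta <= nc (lead_coef q) ->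
  (count (fun j : nat => nc q.[e (j%:R / N%:R)] <= eps) (iota 0 N))%:R <= eta * N%:R.
Proof.
move=> delta0 eta0.
have [r [r0 [N0 hN]]] := arc_count (divr_gt0 eta0 (ltr0Sn R J)).
have rJ : 0 < r ^+ J by rewrite exprn_gt0.
exists (delta * r ^+ J / 2); split; first by rewrite !mulr_gt0.
exists N0 => N NN q sq hq.
have [rs qE] := closed_field_poly_normal q.
have q0 : lead_coef q != 0 by rewrite lead_coef_eq0 -size_poly_eq0 sq.
have srs : size rs = J.
  by have := sq; rewrite qE size_scale// size_prod_XsubC => -[].
have sub j : nc q.[e (j%:R / N%:R)] <= delta * r ^+ J / 2 ->
    has (fun z => nc (e (j%:R / N%:R) - z) <= r) rs.
  move=> h; apply/negP => /negP; rewrite -all_predC => /allP far.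
  move: h; apply/negP; rewrite -ltNge.
  apply: (@lt_le_trans _ _ (delta * r ^+ J)).
    by rewrite ltr_pdivrMr// ltr_pMr ?mulr_gt0// ltr1n.
  rewrite qE hornerZ ncM; apply: ler_pM; rewrite ?(ltW delta0) ?(ltW rJ)//.
  have H (l : seq C) (x : C) : (forall z, z \in l -> r < nc (x - z)) ->
      r ^+ size l <= \prod_(z <- l) nc (x - z).
    elim: l => [|z l IH] hl; first by rewrite big_nil.
    rewrite big_cons exprS; apply: ler_pM; rewrite ?(ltW r0) ?exprn_ge0 ?(ltW r0)//.
      by apply: ltW; apply: hl; rewrite mem_head.
    by apply: IH => y yl; apply: hl; rewrite inE yl orbT.
  rewrite horner_prod nc_prod -srs.
  under [leRHS]eq_bigr do rewrite hornerXsubC.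
  by apply: H => z /far /=; rewrite -ltNge.
apply: (@le_trans _ _ (\sum_(z <- rs) eta / J.+1%:R * N%:R)).
  apply: (@le_trans _ _ (\sum_(z <- rs) (count (fun j : nat => nc (e (j%:R / N%:R) - z) <= r) (iota 0 N))%:R)).
    rewrite -natr_sum ler_nat; apply: leq_trans (count_has _ _ _).
    exact: sub_count.
  by apply: ler_sum => z _; exact: hN.
rewrite big_const_seq count_predT srs iter_addr_0 -[leLHS]mulr_natr.
rewrite (_ : _ * _ = eta * N%:R * (J%:R / J.+1%:R)); last by ring.
by rewrite ler_piMr ?mulr_ge0 ?(ltW eta0)// ler_pdivrMr ?ltr0n// mul1r ler_nat.
Qed.

(** Points are functions on [nat] and frequencies are sequences, read only below [d], so that the
    same data serve in every dimension during inductions. *)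
Definition exp_sum (d : nat) (s : seq (C * seq int)) (x : nat -> R) : C :=
  \sum_(p <- s) p.1 * e (\sum_(i < d) (p.2`_i)%:~R * x i).

Lemma eq_exp_sum d s x y : (forall i, (i < d)%N -> x i = y i) -> exp_sum d s x = exp_sum d s y.
Proof.
move=> xy; apply: eq_bigr => p _; congr (_ * expi (_ * _)).
by apply: eq_bigr => i _; rewrite xy.
Qed.

(* Splitting off the last variable turns an exponential sum into a polynomial in
   [e (x d)] whose coefficients are exponential sums in one variable less. *)
Lemma exp_sum_recr d (s : seq (C * seq int)) (K : nat) (x : nat -> R) :
  (forall p, p \in s -> (absz (p.2`_d)%R <= K)%N) ->
  exp_sum d.+1 s x = e (- (K%:R * x d)) *
    \sum_(j < K.*2.+1) exp_sum d [seq p <- s | p.2`_d + K%:Z == j%:Z] x * e (x d) ^+ j.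
Proof.
move=> hK.
have term (j : 'I_K.*2.+1) : exp_sum d [seq p <- s | p.2`_d + K%:Z == j%:Z] x * e (x d) ^+ j =
   \sum_(p <- s | p.2`_d + K%:Z == j%:Z) p.1 * e (\sum_(i < d) (p.2`_i)%:~R * x i) * e (x d) ^+ j.
  by rewrite /exp_sum big_filter mulr_suml.
under eq_bigr do rewrite term.
rewrite (exchange_big_dep predT)//= mulr_sumr /exp_sum !big_seq; apply: eq_bigr => p ps.
have jge0 : 0 <= p.2`_d + K%:Z :> int by have := hK p ps; lia.
have jlt : (absz (p.2`_d + K%:Z)%R < K.*2.+1)%N by have := hK p ps; lia.
rewrite (bigD1 (Ordinal jlt))/=; last by rewrite gez0_abs.
rewrite [X in _ + X]big1 ?addr0 => [|j /andP[/eqP h1 /eqP h2]]; last first.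
  by exfalso; apply: h2; apply: val_inj => /=; rewrite h1.
rewrite [RHS](_ : _ = p.1 * (e (- (K%:R * x d)) * (e (\sum_(i < d) (p.2`_i)%:~R * x i) *
    e (x d) ^+ absz (p.2`_d + K%:Z)%R))); last by move=> /=; ring.
congr (_ * _).
rewrite -expiX -!expiD big_ord_recr /=; congr expi.
have -> : (absz (p.2`_d + K%:Z)%R)%:R = (p.2`_d)%:~R + K%:R :> R.
  rewrite -[X in _ = _ + X]/(K%:Z%:~R) -intrD -[LHS]/((absz (p.2`_d + K%:Z)%R)%:Z%:~R).
  by rewrite gez0_abs.
by ring.
Qed.

Fixpoint grid (d N : nat) : seq (seq nat) :=
  if d is d'.+1 then [seq rcons g j | g <- grid d' N, j <- iota 0 N] else [:: [::]].

Lemma size_grid d N : size (grid d N) = (N ^ d)%N.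
Proof. by elim: d => //= d IH; rewrite size_allpairs IH size_iota expnSr. Qed.

Lemma mem_grid d N g : (g \in grid d N) = (size g == d) && all (fun j => j < N)%N g.
Proof.
elim: d g => [|d IH] g /=; first by rewrite inE; case: g.
apply/allpairsP/andP => [[[h j] /= [hg jN ->]]|[/eqP sg ag]].
  move: hg jN; rewrite IH mem_iota add0n => /andP[/eqP <- ah] jN.
  by rewrite size_rcons all_rcons ah andbT.
case/lastP: g sg ag => // h j; rewrite size_rcons all_rcons => -[sh] /andP[jN ah].
by exists (h, j); rewrite /= IH sh eqxx ah mem_iota.
Qed.

Definition grid_point (N : nat) (g : seq nat) (i : nat) : R := (nth 0%N g i)%:R / N%:R.

(* Where the leading coefficient in the last variable is not small, only few
   points of the corresponding line of the grid give small values. *)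
Lemma exp_sum_small_count d (s : seq (C * seq int)) : (forall x, exp_sum d s x = 0) \/
  forall eta : R, 0 < eta -> exists eps : R, 0 < eps /\ exists N0 : nat,
    forall N : nat, (N0 <= N)%N ->
    (count (fun g => nc (exp_sum d s (grid_point N g)) <= eps) (grid d N))%:R <= eta * (N ^ d)%:R.
Proof.
elim: d s => [|d IH] s.
  pose c := \sum_(p <- s) p.1.
  have sE x : exp_sum 0 s x = c.
    by apply: eq_bigr => p _; rewrite big_ord0 mulr0 expi0 mulr1.
  have [c0|cn0] := eqVneq c 0; first by left => x; rewrite sE.
  have c0 : 0 < nc c by rewrite nc_gt0.
  right=> eta eta0; exists (nc c / 2); split; first by rewrite divr_gt0.
  exists 0%N => N _ /=; rewrite sE addn0 (_ : (nc c <= nc c / 2) = false) ?mulr1 ?(ltW eta0)//.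
  by apply/negP => h; lra.
pose K := (\sum_(p <- s) absz (p.2`_d)%R)%N.
have hK p : p \in s -> (absz (p.2`_d)%R <= K)%N.
  by move=> ps; rewrite /K (big_rem p ps) leq_addr.
pose sj (j : nat) := [seq p <- s | p.2`_d + K%:Z == j%:Z].
(* The powers of the last variable whose coefficient is not identically zero; [J] is the largest
   one. *)
pose A (j : nat) := `[< ~ forall x, exp_sum d (sj j) x = 0 >] && (j < K.*2.+1)%N.
have [[j0 Aj0]|noA] := pselect (exists j, A j); last first.
  left=> x; rewrite (exp_sum_recr x hK) big1 ?mulr0// => j _.
  rewrite (_ : exp_sum d _ x = 0) ?mul0r//.
  apply: contrapT => h; apply: noA; exists j; rewrite /A ltn_ord andbT.
  by apply/asboolP => /(_ x).
have Abnd j : A j -> (j <= K.*2)%N by move=> /andP[_].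
pose J := ex_maxn (ex_intro _ j0 Aj0) Abnd.
have [AJ Jmax] : A J /\ forall j, A j -> (j <= J)%N.
  by rewrite /J; case: ex_maxnP => i Ai imax; split.
have [/asboolP nzJ JK] := andP AJ.
have small j x : (J < j)%N -> (j < K.*2.+1)%N -> exp_sum d (sj j) x = 0.
  move=> Jj jK; apply: contrapT => h.
  have /Jmax : A j by rewrite /A jK andbT; apply/asboolP => /(_ x).
  by rewrite leqNgt Jj.
pose q (x : nat -> R) : {poly C} := \poly_(j < J.+1) exp_sum d (sj j) x.
have qE x : exp_sum d.+1 s x = e (- (K%:R * x d)) * (q x).[e (x d)].
  rewrite (exp_sum_recr x hK); congr (_ * _).
  rewrite horner_poly -(big_mkord predT (fun j => exp_sum d (sj j) x * e (x d) ^+ j)).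
  rewrite -(big_mkord predT (fun j => exp_sum d (sj j) x * e (x d) ^+ j)).
  rewrite (@big_cat_nat _ _ _ J.+1)//= [X in _ + X]big1_seq ?addr0// => j.
  by move=> /andP[_]; rewrite mem_index_iota => /andP[Jj jK]; rewrite small// mul0r.
right=> eta eta0; have eta20 : 0 < eta / 2 by rewrite divr_gt0.
have [/nzJ //|/(_ _ eta20)[eps1 [eps10 [N1 hN1]]]] := IH (sj J).
have [eps [eps0 [N2 hN2]]] := @small_values_count J eps1 (eta / 2) eps10 eta20.
exists eps; split=> //; exists (maxn N1 N2) => N; rewrite geq_max => /andP[NN1 NN2].
pose bad (g : seq nat) := nc (exp_sum d (sj J) (grid_point N g)) <= eps1.
pose cnt (g : seq nat) := count (fun j => nc (exp_sum d.+1 s (grid_point N (rcons g j))) <= eps) (iota 0 N).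
have -> : count (fun g => nc (exp_sum d.+1 s (grid_point N g)) <= eps) (grid d.+1 N)
    = (\sum_(g <- grid d N) cnt g)%N.
  rewrite -sum1_count big_mkcond big_allpairs_dep /=; apply: eq_bigr => g _.
  by rewrite /cnt -sum1_count [RHS]big_mkcond.
(* A line with small leading coefficient is counted in full, the induction hypothesis making such
   lines rare; on the others [small_values_count] applies. Each case costs half of [eta]. *)
have cntE g : g \in grid d N -> (cnt g)%:R <= (bad g)%:R * N%:R + eta / 2 * N%:R :> R.
  rewrite mem_grid => /andP[/eqP sg _]; case: (boolP (bad g)) => [bg|nbg].
    rewrite mul1r; apply: (@le_trans _ _ N%:R); last by rewrite lerDl mulr_ge0// ltW.
    by rewrite ler_nat (leq_trans (count_size _ _))// size_iota.
  rewrite mul0r add0r.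
  have coefE j k : exp_sum d (sj k) (grid_point N (rcons g j)) = exp_sum d (sj k) (grid_point N g).
    by apply: eq_exp_sum => i id; rewrite /grid_point nth_rcons sg id.
  have qgE j : q (grid_point N (rcons g j)) = q (grid_point N g).
    by apply/polyP => k; rewrite !coef_poly coefE.
  have lc : exp_sum d (sj J) (grid_point N g) != 0.
    by rewrite -nc_gt0; apply: lt_trans eps10 _; rewrite ltNge.
  have sq : size (q (grid_point N g)) = J.+1 by rewrite size_poly_eq.
  have lcq : eps1 <= nc (lead_coef (q (grid_point N g))).
    by rewrite lead_coefE sq coef_poly ltnSn; apply: ltW; rewrite ltNge.
  apply: le_trans (hN2 N NN2 _ sq lcq).
  rewrite ler_nat; apply: sub_count => j /=; rewrite qE ncM nc_expi mul1r qgE.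
  by rewrite /grid_point nth_rcons sg ltnn eqxx.
rewrite natr_sum; apply: (@le_trans _ _ (\sum_(g <- grid d N) ((bad g)%:R * N%:R + eta / 2 * N%:R))).
  by rewrite !big_seq; apply: ler_sum => g; exact: cntE.
rewrite big_split /= -mulr_suml -natr_sum.
rewrite big_const_seq count_predT size_grid iter_addr_0 -[X in _ + X]mulr_natr.
have -> : (\sum_(g <- grid d N) bad g)%N = count bad (grid d N).
  by rewrite -sum1_count [RHS]big_mkcond; apply: eq_bigr => g _; case: (bad g).
have := hN1 N NN1; rewrite -/bad => hb.
rewrite expnSr natrM.
apply: (@le_trans _ _ (eta / 2 * (N ^ d)%:R * N%:R + eta / 2 * N%:R * (N ^ d)%:R)).
  by rewrite lerD2r ler_wpM2r.
by rewrite le_eqVlt; apply/orP; left; apply/eqP; field.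
Qed.

End GridCounting.

(** * Trigonometric sums in several variables *)

Section TrigonometricSums.
Variables (R : realType) (d : nat).
Local Notation C := R[i].

Definition trig_sum (f : 'rV[R]_d -> C) : Prop :=
  exists s : seq (C * 'rV[int]_d), forall theta,
    f theta = \sum_(p <- s) p.1 * expi (2 * pi * dot p.2 theta).

Lemma trig_sum_cst (c : C) : trig_sum (fun=> c).
Proof.
exists [:: (c, 0)] => theta; rewrite big_seq1 /dot big1 ?mulr0 ?expi0 ?mulr1// => i _.
by rewrite mxE mul0r.
Qed.

Lemma trig_sum_char (k : 'rV[int]_d) : trig_sum (fun theta => expi (2 * pi * dot k theta)).
Proof. by exists [:: (1, k)] => theta; rewrite big_seq1 mul1r. Qed.

Lemma trig_sumD f g : trig_sum f -> trig_sum g -> trig_sum (fun theta => f theta + g theta).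
Proof.
by move=> [s hs] [t ht]; exists (s ++ t) => theta; rewrite big_cat /= hs ht.
Qed.

Lemma trig_sumM f g : trig_sum f -> trig_sum g -> trig_sum (fun theta => f theta * g theta).
Proof.
move=> [s hs] [t ht]; exists [seq (p.1 * q.1, p.2 + q.2) | p <- s, q <- t] => theta.
rewrite hs ht mulr_suml big_allpairs_dep /=; apply: eq_bigr => p _.
rewrite mulr_sumr; apply: eq_bigr => q _.
by rewrite dotDl (mulrDr (2 * pi)) expiD; ring.
Qed.

Lemma trig_sum_sum (I : Type) (r : seq I) (P : pred I) (F : I -> 'rV[R]_d -> C) :
  (forall i, P i -> trig_sum (F i)) -> trig_sum (fun theta => \sum_(i <- r | P i) F i theta).
Proof.
move=> h; elim: r => [|i r IH].
  by under eq_fun do rewrite big_nil; exact: trig_sum_cst.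
under eq_fun do rewrite big_cons; case: (boolP (P i)) => // Pi.
exact: trig_sumD (h i Pi) IH.
Qed.

Lemma trig_sum_lipschitz f : trig_sum f -> exists2 L : R, 0 <= L &
  forall (theta eta : 'rV[R]_d) (h : R), (forall i, `|theta 0 i - eta 0 i| <= h) ->
    nc (f theta - f eta) <= L * h.
Proof.
move=> [s hs].
exists (\sum_(p <- s) nc p.1 * (2 * pi * \sum_i `|(p.2 0 i)%:~R|)).
  apply: sumr_ge0 => p _; rewrite mulr_ge0 ?nc_ge0// mulr_ge0 ?sumr_ge0//.
  by rewrite mulr_ge0// pi_ge0.
move=> theta eta h th; rewrite !hs -sumrB mulr_suml.
apply: le_trans (nc_sum _ _ _) _; apply: ler_sum => p _.
rewrite -[X in nc X]mulrBr ncM -[leRHS]mulrA ler_wpM2l ?nc_ge0//.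
apply: (le_trans (expi_lipschitz _ _)).
rewrite -[X in `|X|]mulrBr normrM -[leRHS]mulrA ger0_norm ?mulr_ge0 ?pi_ge0// ler_wpM2l ?mulr_ge0 ?pi_ge0//.
rewrite /dot -sumrB mulr_suml; apply: (le_trans (ler_norm_sum _ _ _)).
by apply: ler_sum => i _; rewrite -mulrBr normrM ler_wpM2l.
Qed.

Lemma null_of_finite_covers (A : set 'rV[R]_d) : (0 < d)%N ->
  (forall eps : R, 0 < eps -> exists (N : nat) (G : seq 'rV[R]_d),
     [/\ (0 < N)%N, (size G)%:R / (N ^ d)%:R <= eps &
         forall x, A x -> exists2 a, a \in G & forall i, a 0 i <= x 0 i <= a 0 i + N%:R^-1]) ->
  lebesgue_null A.
Proof.
move=> d0 H eps eps0; have [N [G [N0 vol cov]]] := H eps eps0.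
have in0 : 0 <= (N%:R^-1 : R) by rewrite invr_ge0.
(* Beyond the end of [G] the boxes degenerate to the origin; their volume is [0] because [0 < d]. *)
pose a n : 'rV[R]_d := if (n < size G)%N then nth 0 G n else 0.
pose b n : 'rV[R]_d := if (n < size G)%N then nth 0 G n + const_mx N%:R^-1 else 0.
exists a, b; split.
- by move=> n i; rewrite /a /b; case: ifP => _ //; rewrite !mxE lerDl.
- move=> x /cov[y yG hy]; exists (index y G) => // i.
  by rewrite /a /b index_mem yG nth_index// !mxE.
- have volE n : \prod_(i < d) (b n 0 i - a n 0 i) = if (n < size G)%N then N%:R^-1 ^+ d else 0.
    rewrite /a /b; case: ifP => _.
      under eq_bigr do rewrite !mxE addrAC subrr add0r.
      by rewrite prodr_const card_ord.
    under eq_bigr do rewrite !mxE subrr.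
    by rewrite prodr_const card_ord expr0n gtn_eqF.
  under eq_eseriesr do rewrite volE.
  have part n : \sum_(0 <= k < n) (if (k < size G)%N then N%:R^-1 ^+ d else 0) =
      (minn n (size G))%:R * N%:R^-1 ^+ d :> R.
    elim: n => [|n IH]; first by rewrite big_geq// min0n mul0r.
    rewrite big_nat_recr//= IH; case: ltnP => h.
      by rewrite -{2}(mul1r (N%:R^-1 ^+ d)) -mulrDl natr1; congr (_%:R * _); lia.
    by rewrite addr0; congr (_%:R * _); lia.
  apply: lime_le.
    apply: is_cvg_nneseries => n _ _; by rewrite lee_fin; case: ifP => // _; rewrite exprn_ge0.
  apply: nearW => n; rewrite sumEFin lee_fin part; apply: le_trans vol.
  rewrite natrX exprVn ler_wpM2r ?invr_ge0 ?exprn_ge0// ler_nat; exact: geq_minr.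
Qed.

(** A zero lies within [1/N] of its lower grid corner, where the Lipschitz bound makes the sum at
    most [eps]; few corners qualify, and their cubes cover the zero set. *)
Lemma trig_sum_zeros_null f : (0 < d)%N -> trig_sum f ->
  (forall theta, f theta = 0) \/ lebesgue_null (@torus R d `&` [set theta | f theta = 0]).
Proof.
move=> d0 trig; have [L L0 hL] := trig_sum_lipschitz trig.
have [s hs] := trig.
pose row (x : nat -> R) : 'rV[R]_d := \row_i x i.
pose s' : seq (C * seq int) := [seq (p.1, [seq (p.2 : 'rV[int]_d) 0 i | i <- enum 'I_d]) | p <- s].
have fE x : f (row x) = exp_sum d s' x.
  rewrite hs /exp_sum big_map; apply: eq_bigr => p _ /=; congr (_ * expi (_ * _)).
  apply: eq_bigr => i _; rewrite mxE (nth_map i) ?size_enum_ord//.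
  by rewrite nth_ord_enum.
have rowE (theta : 'rV[R]_d) : theta = row (fun i => if insub i is Some j then theta 0 j else 0).
  by apply/matrixP => i j; rewrite ord1 mxE valK.
have [z|H] := exp_sum_small_count d s'.
  by left => theta; rewrite (rowE theta) fE.
right; apply: null_of_finite_covers => // eta eta0.
have [eps [eps0 [N0 hN]]] := H eta eta0.
pose N := maxn N0 (Num.truncn (L / eps)).+1.
have NN0 : (N0 <= N)%N by exact: leq_maxl.
have Npos : (0 < N)%N by rewrite /N; apply: leq_trans (leq_maxr _ _).
have n0 : (0 : R) < N%:R by rewrite ltr0n.
have LN : L * N%:R^-1 <= eps.
  rewrite ler_pdivrMr// mulrC -ler_pdivrMr//; apply: ltW.
  by apply: (lt_le_trans (truncnS_gt _)); rewrite ler_nat leq_maxr.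
exists N, [seq row (grid_point R N g) | g <- grid d N & nc (exp_sum d s' (grid_point R N g)) <= eps].
split=> //.
  by rewrite size_map size_filter ler_pdivrMr ?ltr0n ?expn_gt0 ?Npos// hN.
move=> theta [tor f0].
pose h (i : 'I_d) := Num.truncn (N%:R * theta 0 i).
have hP i : (h i)%:R <= N%:R * theta 0 i < (h i).+1%:R.
  by apply: truncn_itv; have /andP[t0 _] := tor i; rewrite mulr_ge0.
pose g := [seq h i | i <- enum 'I_d].
have gE (i : 'I_d) : grid_point R N g i = (h i)%:R / N%:R.
  by rewrite /grid_point (nth_map i) ?size_enum_ord// nth_ord_enum.
have bounds i : (h i)%:R / N%:R <= theta 0 i <= (h i)%:R / N%:R + N%:R^-1.
  have /andP[h1 h2] := hP i; rewrite ler_pdivrMr// mulrC h1 /=.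
  by rewrite -{2}[N%:R^-1]mul1r -mulrDl natr1 ler_pdivlMr// mulrC ltW.
exists (row (grid_point R N g)); last by move=> i; rewrite mxE gE.
apply: map_f; rewrite mem_filter; apply/andP; split.
  rewrite -fE; apply: le_trans LN.
  have := hL (row (grid_point R N g)) theta N%:R^-1; rewrite f0 subr0; apply=> i.
  by rewrite mxE gE; have := bounds i; rewrite ler_norml; lra.
rewrite mem_grid size_map size_enum_ord eqxx /=; apply/allP => _ /mapP[i _ ->].
have /andP[h1 _] := hP i; have /andP[_ t1] := tor i.
by rewrite -(ltr_nat R); apply: le_lt_trans h1 _; rewrite -[ltRHS]mulr1 ltr_pM2l.
Qed.

End TrigonometricSums.

(** * Band functions *)

Lemma perm_prod_XsubC (F : fieldType) (s t : seq F) :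
  \prod_(x <- s) ('X - x%:P) = \prod_(x <- t) ('X - x%:P) -> perm_eq s t.
Proof.
by move=> h; apply/allP => x _ /=; rewrite -!mu_prod_XsubC h.
Qed.

(** * Continuity of sorted roots *)

Section SortedRoots.
Variable R : realType.

Lemma poly_eq_of_horner (p q : {poly R}) : (forall t, p.[t] = q.[t]) -> p = q.
Proof.
move=> h; apply/eqP; rewrite -subr_eq0; apply/negP => /negP pq0.
pose rs := [seq n%:R : R | n <- iota 0 (size (p - q))].
have urs : uniq rs by rewrite map_inj_uniq ?iota_uniq// => x y /eqP; rewrite eqr_nat => /eqP.
have ars : all (root (p - q)) rs.
  by apply/allP => x _; rewrite /root hornerD hornerN h subrr.
by have := max_poly_roots pq0 ars urs; rewrite size_map size_iota ltnn.
Qed.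

(** Used with values of polynomials as [g], to identify the polynomial attached to a cluster point
    of the root vectors. *)
Lemma cluster_eval (T U : topologicalType) (V : T -> U) (x0 : T) (g : U -> R) (v : U) :
  {for v, continuous g} -> (g \o V @ x0 --> g (V x0)) -> cluster (V @ x0) v -> g v = g (V x0).
Proof.
move=> cg gV clv; apply/eqP; rewrite -subr_eq0 -normr_eq0; apply/negP => /negP ne0.
have e0 : 0 < `|g v - g (V x0)| / 2 by rewrite divr_gt0// lt_def ne0 normr_ge0.
have [||y [/= h1 h2]] := clv [set y | `|g y - g (V x0)| < `|g v - g (V x0)| / 2]
                        [set y | `|g v - g y| < `|g v - g (V x0)| / 2].
- have /cvgrPdist_lt/(_ _ e0) := gV; rewrite !near_simpl /=.
  by apply: filterS => t /=; rewrite distrC.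
- by have /cvgrPdist_lt/(_ _ e0) := cg.
have := ler_distD (g y) (g v) (g (V x0)); lra.
Qed.

Lemma continuous_prod_seq (T : topologicalType) (I : Type) (r : seq I) (f : I -> T -> R) (x : T) :
  (forall i, {for x, continuous (f i)}) -> {for x, continuous (fun y => \prod_(i <- r) f i y)}.
Proof.
move=> cf; elim: r => [|i r IH].
  by rewrite (_ : (fun y => _) = cst 1); [exact: cst_continuous|apply/funext => y; rewrite big_nil].
rewrite (_ : (fun y => _) = (fun y => f i y * \prod_(i <- r) f i y)); last first.
  by apply/funext => y; rewrite big_cons.
exact: continuousM.
Qed.

(* A limit of sorted lists of roots of polynomials is a sorted list of roots of
   the limit polynomial; since these lists stay in a compact set, they converge. *)
Lemma continuous_sorted_roots (T : topologicalType) (n : nat) (fl : seq R) (b : T -> seq R) (B : R) :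
  (forall x, size (b x) = n) -> (forall x, sorted <=%R (b x)) ->
  (forall x y, y \in b x -> `|y| <= B) ->
  (forall t, continuous (fun x => (\prod_(y <- fl) (t - y)) * \prod_(y <- b x) (t - y))) ->
  forall j, continuous (fun x => nth 0 (b x) j).
Proof.
move=> sb ob bB cont j x0.
have [nj|jn] := leqP n j.
  rewrite (_ : (fun x => _) = cst 0); first exact: cst_continuous.
  by apply/funext => x; rewrite nth_default ?sb.
pose V (x : T) : 'rV[R]_n := \row_i nth 0 (b x) i.
have VE x (t : R) : \prod_(y <- b x) (t - y) = \prod_(i < n) (t - V x 0 i).
  rewrite (big_nth 0) sb big_mkord; apply: eq_bigr => i _; by rewrite mxE.
(* The margin [1] beyond the bound [B] makes this compact set a neighbourhood of [V x0]. *)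
pose K : set 'rV[R]_n := [set v | forall i, `[- (B + 1), B + 1]%classic (v ord0 i)].
have cK : compact K by apply: (rV_compact (A := fun=> `[- (B + 1), B + 1]%classic)) => i; exact: segment_compact.
have VB x i : `|V x ord0 i| <= B.
  by rewrite mxE; apply: (bB x); apply: mem_nth; rewrite sb.
have FK : (V @ x0) K.
  apply: (@filterS _ (nbhs x0) _ setT); last exact: filterT.
  by move=> x _ i /=; rewrite in_itv /= -ler_norml; apply: (le_trans (VB x i)); rewrite lerDl.
have cl_sub v : cluster (V @ x0) v -> v = V x0.
  move=> clv.
  have coordc i : {for v, continuous (fun u : 'rV[R]_n => u 0 i)} by exact: coord_continuous.
  (* Only the full product is known to be continuous; the constant factor from [fl] is cancelled
     afterwards. *)
  have polyE : \prod_(y <- fl) ('X - y%:P) * \prod_(i < n) ('X - (v 0 i)%:P) =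
               \prod_(y <- fl) ('X - y%:P) * \prod_(i < n) ('X - (V x0 0 i)%:P).
    apply: poly_eq_of_horner => t; rewrite !hornerM !horner_prod.
    under eq_bigr do rewrite hornerXsubC.
    under [X in _ * X = _]eq_bigr do rewrite hornerXsubC.
    under [X in _ = _ * X]eq_bigr do rewrite hornerXsubC.
    apply: (@cluster_eval _ _ V x0 (fun u : 'rV[R]_n => \prod_(y <- fl) (t - y) * \prod_(i < n) (t - u 0 i))) => //.
      apply: continuousM; first exact: cst_continuous.
      apply: (continuous_prod_seq (f := fun i (u : 'rV[R]_n) => t - u 0 i)) => i.
      by apply: continuousB; [exact: cst_continuous|exact: coordc].
    have := cont t x0; rewrite /continuous_at.
    rewrite (_ : (fun x => _) = (fun u : 'rV[R]_n => \prod_(y <- fl) (t - y) * \prod_(i < n) (t - u 0 i)) \o V); last first.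
      by apply/funext => x /=; rewrite VE.
    by rewrite VE.
  have fl0 : \prod_(y <- fl) ('X - y%:P) != 0 :> {poly R} by rewrite monic_neq0// monic_prod_XsubC.
  move/(mulfI fl0): polyE => polyE.
  pose sv := [seq v 0 i | i <- enum 'I_n].
  have bE : b x0 = [seq V x0 0 i | i <- enum 'I_n].
    apply: (@eq_from_nth _ 0); first by rewrite size_map size_enum_ord sb.
    move=> i; rewrite sb => ilt; rewrite (nth_map (Ordinal ilt)) ?size_enum_ord// mxE.
    by rewrite (_ : nth _ _ _ = Ordinal ilt)//; apply: val_inj; rewrite /= nth_enum_ord.
  have pe : perm_eq sv (b x0).
    have h (u : 'rV[R]_n) : \prod_(x <- [seq u 0 i | i <- enum 'I_n]) ('X - x%:P) =
        \prod_(i < n) ('X - (u 0 i)%:P) by rewrite big_map big_enum.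
    by apply: perm_prod_XsubC; rewrite bE /sv !h.
  have svi (i : 'I_n) : nth 0 sv i = v 0 i.
    by rewrite /sv (nth_map i) ?size_enum_ord// nth_ord_enum.
  (* Being sorted is a closed condition, so it passes to cluster points. *)
  have svs : sorted <=%R sv.
    apply/(sortedP 0) => i; rewrite size_map size_enum_ord => ilt.
    have ilt' : (i < n)%N by exact: ltnW.
    have -> : nth 0 sv i = v 0 (Ordinal ilt') := svi (Ordinal ilt').
    have -> : nth 0 sv i.+1 = v 0 (Ordinal ilt) := svi (Ordinal ilt).
    rewrite leNgt; apply/negP => lt.
    have [||y [/= h1 h2]] := clv [set y : 'rV[R]_n | y 0 (Ordinal ilt') <= y 0 (Ordinal ilt)]
                      [set y : 'rV[R]_n | y 0 (Ordinal ilt) < y 0 (Ordinal ilt')].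
    - apply: (@filterS _ (nbhs x0) _ setT); last exact: filterT.
      by move=> x _ /=; rewrite !mxE /=; have /(sortedP 0) := ob x; apply; rewrite sb.
    - have c : {for v, continuous (fun u : 'rV[R]_n => u 0 (Ordinal ilt') - u 0 (Ordinal ilt))}.
        by apply: continuousB; exact: coordc.
      have d0 : 0 < v 0 (Ordinal ilt') - v 0 (Ordinal ilt) by rewrite subr_gt0.
      have /cvgrPdist_lt/(_ _ d0) := c; apply: filterS => y /=.
      by rewrite ltr_norml => /andP[_]; lra.
    by move: h1; rewrite leNgt h2.
  have svE : sv = b x0 by apply: (sorted_eq le_trans le_anti svs (ob x0) pe).
  apply/matrixP => i k; rewrite ord1.
  by rewrite -svi svE mxE.
have clE : cluster (V @ x0) = [set V x0].
  apply/seteqP; split=> [v /cl_sub //|_ ->].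
  have [v [_ clv]] := cK (V @ x0) _ FK.
  by rewrite -(cl_sub v clv).
have nK : nbhs (V x0) K.
  apply/nbhs_ballP; exists 1 => //= y [_ hy] i.
  rewrite /= in_itv /= -ler_norml.
  have := hy 0 i; rewrite /ball /= => h.
  have := VB x0 i; have := ler_distD (V x0 ord0 i) (y ord0 i) 0; rewrite !subr0 distrC => h2 h3.
  by apply: (le_trans h2); rewrite addrC; apply: lerD => //; exact: ltW.
have VC : V @ x0 --> V x0.
  by apply: (compact_cluster_set1 _ cK nK _ FK clE); exact: norm_hausdorff.
have cc : {for V x0, continuous (fun u : 'rV[R]_n => u 0 (Ordinal jn))}.
  exact: coord_continuous.
have := continuous_comp VC cc.
rewrite /continuous_at (_ : _ \o _ = (fun x => nth 0 (b x) j))//.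
by apply/funext => x /=; rewrite mxE.
Qed.

End SortedRoots.

Lemma lebesgue_null_sub (R : realType) d (A B : set 'rV[R]_d) :
  A `<=` B -> lebesgue_null B -> lebesgue_null A.
Proof.
move=> AB nB eps eps0; have [a [b [ab cov vol]]] := nB eps eps0.
by exists a, b; split=> //; exact: subset_trans cov.
Qed.

Lemma conjcR (R : realType) (x : R) : (x%:C)^*%C = x%:C.
Proof. by rewrite /= oppr0. Qed.

(** * Multiplicity and Taylor coefficients *)

Section Multiplicity.
Variable F : fieldType.

(** The coefficients of [p \Po ('X + c%:P)] are the Taylor coefficients of [p] at [c]: they vanish
    below the multiplicity of [c] and not at it. *)
Lemma coef_comp_shift_eq0 (p : {poly F}) (c : F) (m : nat) : p != 0 ->
  (m < mup c p)%N -> (p \Po ('X + c%:P))`_m = 0.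
Proof.
move=> p0; rewrite mup_geq// => /dvdpP[q ->].
rewrite comp_polyM rmorphXn /= comp_polyB comp_polyX comp_polyC addrK mulrC coefXnM.
by rewrite ltnSn.
Qed.

Lemma coef_comp_shift_neq0 (p : {poly F}) (c : F) : p != 0 ->
  (p \Po ('X + c%:P))`_(mup c p) != 0.
Proof.
move=> p0; set m := mup c p.
have : (m <= mup c p)%N by []; rewrite mup_geq// => /dvdpP[q pE].
rewrite pE comp_polyM rmorphXn /= comp_polyB comp_polyX comp_polyC addrK mulrC coefXnM.
rewrite ltnn subnn -horner_coef0 horner_comp hornerD hornerX hornerC add0r.
apply/negP => /factor_theorem[q' qE].
have : (m.+1 <= mup c p)%N by rewrite mup_geq// pE qE -mulrA -exprS dvdp_mull.
by rewrite ltnn.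
Qed.

Lemma mup_gt0 (p : {poly F}) c : p != 0 -> (0 < mup c p)%N = root p c.
Proof. by move=> p0; rewrite -XsubC_dvd// dvdp_XsubCl. Qed.

End Multiplicity.

(** * Generic multiplicity of Floquet eigenvalues *)

Section FloquetBands.
Variables (R : realType) (d nu : nat) (G : periodic_graph R d nu).
Hypothesis lfG : locally_finite_graph G.
Local Notation C := R[i].
Local Notation cp theta := (char_poly (floquet G theta)).

Lemma cp_neq0 theta : cp theta != 0.
Proof. by rewrite monic_neq0// char_poly_monic. Qed.

Lemma trig_sum_floquet a b : trig_sum (fun theta => floquet G theta a b).
Proof.
have [s [us ws]] := locally_finite_range lfG.
under eq_fun do rewrite (floquetE us ws).
apply: trig_sumD; last exact: trig_sum_cst.
apply: trig_sum_sum => k _; apply: trig_sumM; first exact: trig_sum_cst.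
exact: trig_sum_char.
Qed.

Definition trig_poly (p : 'rV[R]_d -> {poly C}) : Prop :=
  forall i, trig_sum (fun theta => (p theta)`_i).

Lemma trig_poly_cst (p : {poly C}) : trig_poly (fun=> p).
Proof. by move=> i; exact: trig_sum_cst. Qed.

Lemma trig_polyM p q : trig_poly p -> trig_poly q -> trig_poly (fun theta => p theta * q theta).
Proof.
move=> hp hq i; under eq_fun do rewrite coefM.
by apply: trig_sum_sum => j _; apply: trig_sumM.
Qed.

Lemma trig_poly_sum (I : Type) (r : seq I) (P : pred I) (p : I -> 'rV[R]_d -> {poly C}) :
  (forall i, P i -> trig_poly (p i)) -> trig_poly (fun theta => \sum_(i <- r | P i) p i theta).
Proof.
move=> h i; under eq_fun do rewrite coef_sum.
by apply: trig_sum_sum => j Pj; exact: h.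
Qed.

Lemma trig_poly_prod (I : Type) (r : seq I) (p : I -> 'rV[R]_d -> {poly C}) :
  (forall i, trig_poly (p i)) -> trig_poly (fun theta => \prod_(i <- r) p i theta).
Proof.
move=> h; elim: r => [|i r IH].
  by under eq_fun do rewrite big_nil; exact: trig_poly_cst.
by under eq_fun do rewrite big_cons; exact: trig_polyM.
Qed.

Lemma char_poly_mx_shiftE (A : 'M[C]_nu) (c : C) a b :
  map_mx (comp_poly ('X + c%:P)) (char_poly_mx A) a b = ('X + c%:P) *+ (a == b) - (A a b)%:P.
Proof. by rewrite !mxE raddfB /= comp_polyC raddfMn /= comp_polyX. Qed.

Lemma trig_poly_char_poly_shift (c : C) : trig_poly (fun theta => cp theta \Po ('X + c%:P)).
Proof.
under eq_fun do rewrite /char_poly -[_ \Po _]/(comp_poly ('X + c%:P) _) -det_map_mx /determinant.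
apply: trig_poly_sum => s _; apply: trig_polyM; first exact: trig_poly_cst.
apply: trig_poly_prod => a i.
under eq_fun do rewrite char_poly_mx_shiftE coefB [X in _ - X]coefC.
apply: trig_sumD; first exact: trig_sum_cst.
case: (i == 0)%N; last first.
  by under eq_fun do rewrite oppr0; exact: trig_sum_cst.
under eq_fun do rewrite -mulN1r.
by apply: trig_sumM; [exact: trig_sum_cst|exact: trig_sum_floquet].
Qed.

Lemma generic_multiplicity (c : C) : (0 < d)%N ->
  exists m : nat, [/\ forall theta, (m <= mup c (cp theta))%N,
    exists theta, mup c (cp theta) = m &
    lebesgue_null (@torus R d `&` [set theta | (m < mup c (cp theta))%N])].
Proof.
move=> d0.
pose Q m := `[< exists theta, mup c (cp theta) = m >].
have exQ : exists m, Q m by exists (mup c (cp 0)); apply/asboolP; exists 0.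
have /asboolP[theta0 h0] : Q (ex_minn exQ) by case: ex_minnP.
have mmin theta : (ex_minn exQ <= mup c (cp theta))%N.
  by case: ex_minnP => m _; apply; apply/asboolP; exists theta.
move: (ex_minn exQ) h0 mmin => m h0 mmin; exists m; split=> //; first by exists theta0.
(* The [m]-th Taylor coefficient at [c] is not zero at [theta0], but vanishes wherever the
   multiplicity exceeds [m]. *)
have [z|] := trig_sum_zeros_null d0 (trig_poly_char_poly_shift c m).
  by have := coef_comp_shift_neq0 c (cp_neq0 theta0); rewrite h0 z eqxx.
apply: lebesgue_null_sub => theta [tor h]; split=> //=.
exact: coef_comp_shift_eq0 (cp_neq0 theta) h.
Qed.

(** If the least multiplicity of [lambda] is positive, the band is flat; if it is [0], being an
    eigenvalue means exceeding it. *)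
Lemma flat_or_null (lambda : C) : (0 < d)%N -> flat_band G lambda \/
  lebesgue_null (@torus R d `&` [set theta | eigenvalue (floquet G theta) lambda]).
Proof.
move=> d0; have [m [hm _ nul]] := generic_multiplicity lambda d0.
have evE theta : eigenvalue (floquet G theta) lambda = (0 < mup lambda (cp theta))%N.
  by rewrite eigenvalue_root_char mup_gt0// cp_neq0.
case: m hm nul => [|m] hm nul; last by left=> theta; rewrite evE (leq_trans _ (hm theta)).
by right; apply: lebesgue_null_sub nul => theta [tor h]; split=> //=; rewrite -evE.
Qed.

Lemma mup_prod_real (s : seq R) (c : R) :
  mup c%:C (\prod_(x <- s) ('X - (x%:C)%:P)) = count_mem c s.
Proof.
rewrite -(big_map (real_complex R) xpredT (fun y => 'X - y%:P)) mu_prod_XsubC count_map.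
by apply: eq_count => x /=; rewrite (inj_eq (@complexI R)).
Qed.

Lemma count_mem_map_enum n (f : 'I_n -> R) (c : R) :
  count_mem c [seq f i | i <- enum 'I_n] = #|[pred i | f i == c]|.
Proof. by rewrite count_map -sum1_count big_enum_cond /= sum1_card. Qed.

(** By the convention on flat bands, at least [m] band functions are constantly [c]. A non-constant
    [E j] is not one of them, so where it equals [c] the multiplicity exceeds [m]. *)
Lemma band_constant_or_null (E : 'I_nu -> 'rV[R]_d -> R) (j : 'I_nu) : (0 < d)%N ->
  band_functions G E -> constant_on [set: 'rV[R]_d] (E j) \/
  forall c : R, lebesgue_null (@torus R d `&` [set theta | E j theta = c]).
Proof.
move=> d0 [cE pE chE flE].
have [cst|ncst] := pselect (constant_on [set: 'rV[R]_d] (E j)); first by left.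
right=> c; have [m [hm _ nul]] := generic_multiplicity c%:C d0.
have := flE c m hm; set S := [set j | _] => mS.
have mupE theta : mup c%:C (cp theta) = #|[pred i | E i theta == c]|.
  have -> : cp theta = \prod_(x <- [seq E i theta | i <- enum 'I_nu]) ('X - (x%:C)%:P).
    by rewrite chE big_map big_enum.
  by rewrite mup_prod_real count_mem_map_enum.
apply: lebesgue_null_sub nul => theta [tor /= Ej]; split=> //=.
rewrite mupE; apply: (leq_ltn_trans mS).
rewrite (cardD1 j [pred i | E i theta == c]) inE Ej eqxx add1n ltnS; apply: subset_leq_card.
apply/fintype.subsetP => i; rewrite !inE => /asboolP iS.
rewrite iS eqxx andbT; apply/eqP => ij; apply: ncst; exists c => t _.
by rewrite -ij iS.
Qed.

Lemma adjmx_floquet theta : adjmx (floquet G theta) = floquet G theta.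
Proof.
have [s [us ws]] := locally_finite_range lfG.
(* One side is expanded over the opposite displacements, so that the symmetry of the weight applies
   term by term. *)
have us' : uniq [seq - k | k <- s] by rewrite map_inj_uniq//; exact: oppr_inj.
have ws' a b k : weight G a b k != 0 -> k \in [seq - k | k <- s].
  by rewrite weight_sym => /ws h; apply/mapP; exists (- k); rewrite ?opprK.
apply/matrixP => a b.
have -> : adjmx (floquet G theta) a b = (floquet G theta b a)^*%C by rewrite [LHS]mxE [X in X^*%C]mxE.
rewrite (floquetE us' ws') (floquetE us ws) big_map [(_ + _)^*%C]rmorphD rmorph_sum rmorphMn.
congr (_ + _); last first.
  rewrite -[X in X *+ _ = _]/(((potential G b)%:C)^*%C) conjcR.
  by case: eqVneq => [->|].
apply: eq_bigr => k _; rewrite -[LHS]/(((weight G b a (- k))%:C * expi (2 * pi * dot (- k) theta))^*%C).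
rewrite [LHS]rmorphM -[X in X * _ = _]/(((weight G b a (- k))%:C)^*%C) conjcR.
rewrite -[X in _ * X = _]/((expi (2 * pi * dot (- k) theta))^*%C) conjc_expi -weight_sym.
congr (_ * expi _); rewrite /dot -mulrN -sumrN; congr (_ * _).
by apply: eq_bigr => i _; rewrite mxE rmorphN mulNr opprK.
Qed.

End FloquetBands.

(** * Hermitian matrices *)

Section Hermitian.
Variable R : realType.
Local Notation C := R[i].

Lemma adjmxZ m n (a : C) (A : 'M[C]_(m, n)) : adjmx (a *: A) = a^*%C *: adjmx A.
Proof. by apply/matrixP => i j; rewrite !mxE rmorphM. Qed.

Lemma hermitian_eigenvalue_real n (A : 'M[C]_n) (lambda : C) :
  adjmx A = A -> eigenvalue A lambda -> lambda = (complex.Re lambda)%:C.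
Proof.
move=> AA /eigenvalueP[v vA v0].
have h : v *m A *m adjmx v = lambda *: (v *m adjmx v) by rewrite vA -scalemxAl.
have : (lambda^*%C - lambda) *: (v *m adjmx v) = 0.
  rewrite scalerBl -h -[X in X *: _]/(lambda^*%C).
  have := congr1 (@adjmx _ _ _) h; rewrite adjmxZ !adjmxM adjmxK AA => <-.
  by rewrite mulmxA subrr.
move/eqP; rewrite scaler_eq0 => /orP[|/eqP/mulmx_adjmx_eq0/eqP]; last by rewrite (negPf v0).
rewrite subr_eq0 => /eqP; case: lambda {h vA} => x y /= [] yy.
by congr (_ +i* _); lra.
Qed.

(** The sums of moduli of the entries of [v *m A] and [v] are compared. The bound keeps Floquet
    eigenvalues in an interval independent of [theta]. *)
Lemma eigenvalue_bound n (A : 'M[C]_n) (B : R) (lambda : C) :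
  (forall a b, nc (A a b) <= B) -> eigenvalue A lambda -> nc lambda <= n%:R * B.
Proof.
move=> AB /eigenvalueP[v vA v0].
pose S := \sum_i nc (v 0 i).
have S0 : 0 < S.
  have /rV0Pn[i vi] := v0.
  rewrite /S (bigD1 i)//= ltr_pwDl ?nc_gt0// sumr_ge0// => j _; exact: nc_ge0.
rewrite -(ler_pM2r S0) {1}/S mulr_sumr.
have -> : n%:R * B * S = \sum_(i < n) \sum_j nc (v 0 j) * B.
  by rewrite sumr_const card_ord -mulr_suml -/S -mulr_natr; ring.
apply: ler_sum => i _.
have := congr1 (fun M : 'rV[C]_n => M 0 i) vA; rewrite /= [RHS]mxE -ncM => <-.
rewrite mxE; apply: le_trans (nc_sum _ _ _) _; apply: ler_sum => j _.
by rewrite ncM ler_wpM2l ?nc_ge0.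
Qed.

Lemma hermitian_char_poly n (A : 'M[C]_n) : adjmx A = A ->
  exists rs : seq R, sorted <=%R rs /\ char_poly A = \prod_(x <- rs) ('X - (x%:C)%:P).
Proof.
move=> AA; have [r] := closed_field_poly_normal (char_poly A).
rewrite (monicP (char_poly_monic A)) scale1r => rE.
exists (sort <=%R (map (@complex.Re R) r)); split; first exact/sort_sorted/le_total.
rewrite (perm_big (map (@complex.Re R) r)) ?perm_sort// big_map rE.
apply: eq_big_seq => z zr; congr (_ - _%:P); apply: hermitian_eigenvalue_real AA _.
by rewrite eigenvalue_root_char rE root_prod_XsubC.
Qed.

End Hermitian.

Lemma count_mem_le_card (T : eqType) (x0 : T) (s : seq T) (n : nat) (x : T) (P : pred 'I_n) :
  (size s <= n)%N -> (forall i : 'I_n, (i < size s)%N -> nth x0 s i = x -> P i) ->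
  (count_mem x s <= #|P|)%N.
Proof.
move=> sn sP; rewrite -sum1_count (big_nth x0) big_mkord.
rewrite (big_ord_widen_cond n (fun i => nth x0 s i == x) (fun=> 1%N))//= sum1_card.
apply: subset_leq_card; apply/fintype.subsetP => i; rewrite !unfold_in => /andP[/eqP h i_s].
exact: sP.
Qed.

Lemma continuous_of_lipschitz (R : realType) d (g : 'rV[R]_d -> R) (L : R) :
  (forall (theta eta : 'rV[R]_d) (h : R), (forall i, `|theta 0 i - eta 0 i| <= h) -> `|g theta - g eta| <= L * h) ->
  0 <= L -> continuous g.
Proof.
move=> gL L0 theta V /nbhs_ballP[e /= e0 eV].
have L1 : 0 < L + 1 by lra.
apply/nbhs_ballP; exists (e / (L + 1)) => /=; first exact: divr_gt0.
move=> eta [r0 h]; apply: eV; apply: (@le_lt_trans _ _ (L * (e / (L + 1)))).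
  by apply: gL => i; apply: ltW; exact: h.
by rewrite mulrA ltr_pdivrMr// mulrC ltr_pM2l//; lra.
Qed.

(** * Construction of band functions *)

Section Existence.
Variables (R : realType) (d nu : nat) (G : periodic_graph R d nu).
Hypothesis lfG : locally_finite_graph G.
Local Notation C := R[i].
Local Notation cp theta := (char_poly (floquet G theta)).

Lemma floquet_periodic theta (k : 'rV[int]_d) :
  floquet G (theta + map_mx intr k) = floquet G theta.
Proof.
have [s [us ws]] := locally_finite_range lfG.
apply/matrixP => a b; rewrite !(floquetE us ws); congr (_ + _).
apply: eq_bigr => m _; congr (_ * _).
have -> : dot m (theta + map_mx intr k) = dot m theta + (\sum_i m 0 i * k 0 i)%:~R :> R.
  rewrite /dot rmorph_sum -big_split; apply: eq_bigr => i _ /=.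
  by rewrite !mxE mulrDr rmorphM.
by rewrite mulrDr expiD expi_2pi_int mulr1.
Qed.

Lemma floquet_bounded : exists B : R, forall theta a b, nc (floquet G theta a b) <= B.
Proof.
have [s [us ws]] := locally_finite_range lfG.
pose t a b := \sum_(k <- s) `|weight G a b k| + `|potential G a|.
have t0 a b : 0 <= t a b by rewrite addr_ge0 ?sumr_ge0.
exists (\sum_a \sum_b t a b) => theta a b.
apply: (@le_trans _ _ (t a b)); last first.
  rewrite (bigD1 a)//= (bigD1 b)//= -addrA lerDl addr_ge0 ?sumr_ge0// => i _.
  by rewrite sumr_ge0.
rewrite (floquetE us ws); apply: le_trans (ncD _ _) _; apply: lerD.
  apply: le_trans (nc_sum _ _ _) _; apply: ler_sum => k _.
  by rewrite ncM nc_expi mulr1 nc_real.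
by case: (a == b); [rewrite nc_real|rewrite [X in nc X](_ : _ = 0)// nc0].
Qed.

Lemma trig_sum_char_poly_horner (c : C) : trig_sum (fun theta => (cp theta).[c]).
Proof.
have h := trig_poly_char_poly_shift lfG c 0%N; move: h; congr trig_sum.
apply/funext => theta; rewrite -horner_coef0 horner_comp.
by rewrite hornerD hornerX hornerC add0r.
Qed.

Lemma sorted_roots_unique (s t : seq R) : sorted <=%R s -> sorted <=%R t ->
  \prod_(x <- s) ('X - (x%:C)%:P) = \prod_(x <- t) ('X - (x%:C)%:P) -> s = t.
Proof.
move=> ss st h; apply: (sorted_eq le_trans le_anti) => //.
apply/allP => x _ /=; rewrite -!mup_prod_real; by rewrite h.
Qed.

Lemma band_functions_exist : (0 < d)%N ->
  exists E : 'I_nu -> 'rV[R]_d -> R, band_functions G E.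
Proof.
move=> d0.
have [rs rsP] := choice (fun theta => hermitian_char_poly (adjmx_floquet lfG theta)).
have [mf mfP] := choice (fun c : R => generic_multiplicity lfG c%:C d0).
have countE theta x : count_mem x (rs theta) = mup x%:C (cp theta).
  by rewrite (rsP theta).2 mup_prod_real.
(* Only an eigenvalue at [theta = 0] can have positive least multiplicity, so the constant bands
   form a finite list. *)
pose flats := flatten [seq nseq (mf x) x | x <- undup (rs 0)].
have flatsE x : count_mem x flats = mf x.
  rewrite count_flatten -map_comp sumnE big_map.
  under eq_bigr do rewrite /= count_nseq.
  have [xr|xr] := boolP (x \in undup (rs 0)).
    rewrite (bigD1_seq x) ?undup_uniq//= eqxx mul1n big1 ?addn0// => y /negPf yx.
    by rewrite yx.
  have -> : mf x = 0%N.
    have [h _ _] := mfP x; apply/eqP; rewrite -leqn0 (leq_trans (h 0))//.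
    by rewrite -countE leqn0; apply/eqP/count_memPn; rewrite -mem_undup.
  rewrite big1_seq// => y /andP[_ yr] /=; have [yx|//] := eqVneq y x.
  by rewrite yx (negPf xr) in yr.
(* At every [theta] the list [flats] is contained, with multiplicity, in the list of eigenvalues. *)
have restP theta : exists t, sorted <=%R t /\ perm_eq (rs theta) (flats ++ t).
  have /count_subseqP[s ss fs] : forall x, (count_mem x flats <= count_mem x (rs theta))%N.
    by move=> x; rewrite flatsE countE; have [h _ _] := mfP x.
  have [t ht] := perm_to_subseq ss; exists (sort <=%R t); split.
    exact/sort_sorted/le_total.
  by apply: perm_trans ht _; apply: perm_cat; rewrite perm_sym ?perm_sort.
have [rest hrest] := choice restP.
have cpE theta : cp theta = \prod_(x <- flats ++ rest theta) ('X - (x%:C)%:P).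
  by rewrite (rsP theta).2; apply: perm_big; exact: (hrest theta).2.
have sizeE theta : size (flats ++ rest theta) = nu.
  apply/eqP; rewrite -eqSS -(size_char_poly (floquet G theta)) cpE.
  by rewrite -(big_map (real_complex R) xpredT (fun y => 'X - y%:P)) size_prod_XsubC size_map.
have fl_nu : (size flats <= nu)%N by rewrite -(sizeE 0) size_cat leq_addr.
exists (fun j theta => nth 0 (flats ++ rest theta) j); split.
- move=> j; have [jf|fj] := ltnP j (size flats).
    under eq_fun do rewrite nth_cat jf.
    exact: cst_continuous.
  under eq_fun do rewrite nth_cat ltnNge fj /=.
  have [B hB] := floquet_bounded.
  apply: (@continuous_sorted_roots _ _ (nu - size flats) flats rest (nu%:R * B)).
  + by move=> theta; rewrite -(sizeE theta) size_cat addKn.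
  + by move=> theta; have [] := hrest theta.
  + move=> theta y yr; rewrite -nc_real; apply: eigenvalue_bound (hB theta) _.
    rewrite eigenvalue_root_char cpE -(big_map (real_complex R) xpredT (fun y => 'X - y%:P)).
    by rewrite root_prod_XsubC map_f// mem_cat yr orbT.
  + move=> t; have [L L0 hL] := trig_sum_lipschitz (trig_sum_char_poly_horner t%:C).
    apply: continuous_of_lipschitz L0 => theta eta h hh.
    apply: le_trans (hL _ _ _ hh); rewrite -nc_real rmorphB.
    have evE x : (cp x).[t%:C] =
        (\prod_(y <- flats) (t - y) * \prod_(y <- rest x) (t - y))%:C.
      rewrite -big_cat cpE horner_prod rmorph_prod; apply: eq_bigr => y _.
      by rewrite hornerXsubC rmorphB.
    by rewrite !evE.
- move=> j theta k; congr nth; congr cat.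
  apply: sorted_roots_unique; [exact: (hrest _).1|exact: (hrest _).1|].
  have := cpE (theta + map_mx intr k); rewrite floquet_periodic cpE !big_cat /= => h.
  apply/esym; apply: mulfI h.
  by rewrite monic_neq0// monic_prod_XsubC.
- by move=> theta; rewrite cpE (big_nth 0) sizeE big_mkord.
(* [lambda] occurs in [flats] as often as its least multiplicity, which is attained at [theta0] and
   bounds [m]. *)
- move=> lambda m hm; have [_ [theta0 h0] _] := mfP lambda.
  apply: (leq_trans (hm theta0)); rewrite h0 -flatsE.
  apply: (count_mem_le_card (x0 := 0)) fl_nu _ => i i_f iE.
  by rewrite inE; apply/asboolP => theta; rewrite nth_cat i_f.
Qed.

End Existence.

Theorem theorem4p1 (R : realType) :
  (* (i), (ii) *)
  (exists lambda0 : R[i],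
     infinitely_degenerate (@gamma_adjacency R) lambda0 /\
     ~ (exists psi : int -> R[i],
          finite_support_eigenvector (@gamma_adjacency R) lambda0 psi)) /\
  (* (iii) *)
  ((exists S : set R,
      [/\ measurable S, S `<=` `[0, 1[, (0 < lebesgue_measure S)%E
        & constant_on S (@gamma_floquet R)]) /\
   ~ constant_on [set: R] (@gamma_floquet R)) /\
  (* (i) is impossible in the locally finite setting, for one-vertex cells *)
  (forall (d : nat) (G : periodic_graph R d 1), (0 < d)%N ->
     connected_graph G -> locally_finite_graph G ->
     ~ (exists lambda : R[i], infinitely_degenerate (schrodinger G) lambda) /\
     ~ (exists lambda : R[i], flat_band G lambda)) /\
  (* (ii) is impossible in the locally finite setting *)
  (forall (d nu : nat) (G : periodic_graph R d nu), (0 < d)%N -> (0 < nu)%N ->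
     connected_graph G -> locally_finite_graph G ->
     forall lambda : R[i],
       infinitely_degenerate (schrodinger G) lambda \/ flat_band G lambda ->
       exists psi : vertex d nu -> R[i],
         finite_support_eigenvector (schrodinger G) lambda psi) /\
  (* (iii) is impossible in the locally finite setting *)
  (forall (d nu : nat) (G : periodic_graph R d nu), (0 < d)%N -> (0 < nu)%N ->
     connected_graph G -> locally_finite_graph G ->
     (exists E : 'I_nu -> 'rV[R]_d -> R, band_functions G E) /\
     (forall E : 'I_nu -> 'rV[R]_d -> R, band_functions G E -> forall j : 'I_nu,
        constant_on [set: 'rV[R]_d] (E j) \/
        forall c : R, lebesgue_null (@torus R d `&` [set theta | E j theta = c])) /\
     (forall lambda : R[i],
        flat_band G lambda \/
        lebesgue_null (@torus R d `&`
                  [set theta | eigenvalue (floquet G theta) lambda]))).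
Proof.
have nonzero_of_degenerate d nu (G : periodic_graph R d nu) lambda :
    infinitely_degenerate (schrodinger G) lambda ->
    exists psi, eigenvector (schrodinger G) lambda psi.
  (* A free family with a single member is a nonzero vector. *)
  move=> /(_ 1%N)[psi [eig free]]; exists (psi ord0); split=> //.
  apply: contrapT => h; have /(_ ord0)/eqP : forall i : 'I_1, (1 : R[i]) = 0.
    apply: (free (fun=> 1)) => x; rewrite big_ord1 mul1r.
    by apply/eqP/negPn/negP => hx; apply: h; exists x.
  by rewrite oner_eq0.
have finite_support d nu (G : periodic_graph R d nu) lambda : locally_finite_graph G ->
    infinitely_degenerate (schrodinger G) lambda \/ flat_band G lambda ->
    exists psi, finite_support_eigenvector (schrodinger G) lambda psi.
  move=> lfG [/nonzero_of_degenerate[psi]|].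
    exact: l2_eigenvector_finite_support.
  exact: flat_band_finite_support.
split; [|split; [|split; [|split]]].
- have [E hE] := gamma_infinitely_degenerate R; exists E%:C; split=> //.
  exact: gamma_no_finite_support.
- split.
    exists `[5 / 16 : R, 3 / 8]%classic; split.
    + exact: measurable_itv.
    + by move=> t /=; rewrite !in_itv /= => /andP[h1 h2]; lra.
    + by rewrite lebesgue_measure_itv /= lte_fin ifT -?EFinB ?lte_fin; lra.
    + exists (gamma_floquet (5 / 16)) => t /=; rewrite in_itv /= => ht.
      rewrite !gamma_floquetE; congr (_ +i* _); apply: gamma_band_flat => //; lra.
  case=> c hc; apply: (@gamma_band_nonconst R).
  have := hc 0 I; rewrite -(hc 2^-1 I) !gamma_floquetE.
  exact: complexI.
- move=> d G d0 cG lfG; split=> -[lambda h].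
    by apply: (no_finite_support_one_vertex (lambda := lambda) d0 cG lfG); apply: finite_support => //; left.
  by apply: (no_finite_support_one_vertex (lambda := lambda) d0 cG lfG); apply: finite_support => //; right.
- by move=> d nu G _ _ _ lfG lambda; exact: finite_support.
- move=> d nu G d0 _ _ lfG; split; [|split].
  + exact: band_functions_exist.
  + by move=> E EG j; exact: band_constant_or_null.
  + by move=> lambda; exact: flat_or_null.
Qed.
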